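(* Let $g\colon[0,T]\times\mathbb{R}\times\mathbb{R}^d\to\mathbb{R}$ be measurable with $\int_0^T|g(t,0,0)|^2dt<\infty$ and such that for some constant $[g]_L>0$, for $dt$-a.e. $t$, $|g(t,y_1,z_1)-g(t,y_2,z_2)|\le[g]_L(|y_1-y_2|+|z_1-z_2|)$ for all $(y_1,z_1),(y_2,z_2)$. Let $\pi=\{0=t_0<\dots<t_n=T\}$ be a partition of $[0,T]$ with $|\pi|<[g]_L^{-1}$, and let $p,M\in\mathbb{N}$. Then, for all $\xi\in L^2(\mathcal{F}_T)$, $$\max_{0\le i\le n}\mathbb{E}\big|\mathscr{Y}_i^\pi(X_{t_i},\xi)-\mathscr{Y}_i^{\pi,p,M}(X_{t_i},\xi)\big|^2+\sum_{i=0}^{n-1}\mathbb{E}\Big[\int_{t_i}^{t_{i+1}}\big|\mathscr{Z}_i^\pi(X_{t_i},\xi)-\mathscr{Z}_i^{\pi,p,M}(X_{t_i},\xi)\big|^2dt\Big]\le C\,\mathbb{E}|\xi-\Pi_{p,M}(\xi)|^2,$$ where $C>0$ is a constant depending only on $[g]_L$ and $T$.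
   Context: $T>0$; $B$ is a standard $d$-dimensional Brownian motion on $[0,T]$ on a complete probability space $(\Omega,\mathcal{F},\mathbb{P})$; $(\mathcal{F}_t)_{t\in[0,T]}$ is its natural augmented filtration; $\mathbb{E}_t[\cdot]=\mathbb{E}[\cdot\mid\mathcal{F}_t]$; $L^2(\mathcal{F}_T)$ is the space of real square-integrable $\mathcal{F}_T$-measurable random variables. Scheme: with $\Delta t_i=t_{i+1}-t_i$, $\Delta B_i=B_{t_{i+1}}-B_{t_i}$, $|\pi|=\max_i\Delta t_i$, set $\mathcal{Y}_n^\pi(\xi)=\xi$, $\mathcal{Z}_n^\pi(\xi)=0$ and, for $i=n-1,\dots,0$, $$\mathcal{Z}_i^\pi(\xi)=\frac1{\Delta t_i}\mathbb{E}_{t_i}\big[\mathcal{Y}_{i+1}^\pi(\xi)\Delta B_i\big],\qquad\mathcal{Y}_i^\pi(\xi)=\mathbb{E}_{t_i}\big[\mathcal{Y}_{i+1}^\pi(\xi)\big]+\Delta t_i\,g(t_i,\mathcal{Y}_i^\pi(\xi),\mathcal{Z}_i^\pi(\xi)),$$ the second equation being implicit; the scheme is well defined when $|\pi|<[g]_L^{-1}$. Chaos: $H_0(x)=1$, $H_n(x)=\frac{(-1)^n}{n!}e^{x^2/2}\frac{d^n}{dx^n}(e^{-x^2/2})$ for $n\ge1$. $\mathcal{A}$ is the set of all sequences $a=(a_1,a_2,\dots)$ of non-negative integers with finitely many nonzero terms, $|a|=\sum_ia_i$, $a!=\prod_ia_i!$; $(h_i)_{i\ge1}$ is an orthonormal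 basis of $L^2([0,T];\mathbb{R}^d)$; $X$ is the $\mathbb{R}^{\mathcal{A}}$-valued process $X_t^a=\prod_{i\ge1}H_{a_i}\big(\int_0^th_i(s)\cdot dB_s\big)$. Every $\xi\in L^2(\mathcal{F}_T)$ has the Wiener chaos decomposition $\xi=\sum_{k\ge0}\sum_{|a|=k}d_aX_T^a$ with $d_a=a!\,\mathbb{E}[\xi X_T^a]$, and $\Pi_{p,M}(\xi)=\sum d_aX_T^a$, the sum being over $a\in\mathcal{A}$ with $|a|\le p$ and $a_k=0$ for all $k>M$. $\mathscr{Y}_i^\pi\colon\mathbb{R}^{\mathcal{A}}\times L^2(\mathcal{F}_T)\to\mathbb{R}$ and $\mathscr{Z}_i^\pi\colon\mathbb{R}^{\mathcal{A}}\times L^2(\mathcal{F}_T)\to\mathbb{R}^d$ are measurable maps (which exist) such that $\mathcal{Y}_i^\pi(\xi)=\mathscr{Y}_i^\pi(X_{t_i},\xi)$ and $\mathcal{Z}_i^\pi(\xi)=\mathscr{Z}_i^\pi(X_{t_i},\xi)$ $\mathbb{P}$-a.s. for all $\xi\in L^2(\mathcal{F}_T)$. Their finite-dimensional approximations are $\mathscr{Y}_i^{\pi,p,M}(x,\xi):=\mathscr{Y}_i^\pi(x,\Pi_{p,M}(\xi))$ and $\mathscr{Z}_i^{\pi,p,M}(x,\xi):=\mathscr{Z}_i^\pi(x,\Pi_{p,M}(\xi))$.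
   Formalization: As stated the claim is false: C cannot be uniform as |π| approaches 1/[g]_L, and an a.e. Lipschitz bound says nothing at grid times. Here C depends on [g]_L, T and a bound ρ<1/[g]_L with |π|≤ρ, and the Lipschitz bound is also assumed at t_0,…,t_{n-1}. *)

(* Defs.v *)
From HB Require Import structures.
From mathcomp Require Import all_boot all_order all_algebra finmap.
From mathcomp Require Import all_classical all_reals all_analysis.

Set Implicit Arguments.
Unset Strict Implicit.
Unset Printing Implicit Defensive.

Import Order.TTheory GRing.Theory Num.Theory.
Import numFieldNormedType.Exports.

Local Open Scope classical_set_scope.
Local Open Scope ring_scope.

(* The norm of the library on ['rV[R]_d] is the sup norm; R^d carries the
   Euclidean one here. *)
Definition dot (R : realType) (d : nat) (x y : 'rV[R]_d) : R :=
  \sum_(k < d) x 0 k * y 0 k.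

Definition enorm (R : realType) (d : nat) (x : 'rV[R]_d) : R :=
  Num.sqrt (dot x x).

Section RandomVariables.
Context (R : realType) (disp : measure_display) (Omega : measurableType disp)
  (P : probability Omega R).
Implicit Types (G : set (set Omega)) (X Y : Omega -> R).

(* [G] stands for a sub-sigma-algebra of the sigma-algebra of [Omega] *)
Definition measurable_wrt G X : Prop :=
  forall U : set R, measurable U -> G (X @^-1` U).

Definition mutually_independent (I : finType) (X : I -> Omega -> R) : Prop :=
  forall U : I -> set R, (forall i, measurable (U i)) ->
    P (\bigcap_(i in [set: I]) (X i @^-1` U i)) =
    (\prod_(i : I) P (X i @^-1` U i))%E.

(* Random variables are not identified modulo a.s. equality. *)
Definition L2 G : set (Omega -> R) :=
  [set X | measurable_wrt G X /\ ('E_P[fun w => (X w ^+ 2)%R] < +oo)%E].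

(* [Y] is a version of E[X | G] *)
Definition is_cond_exp G X Y : Prop :=
  [/\ P.-integrable setT (EFin \o X), P.-integrable setT (EFin \o Y),
      measurable_wrt G Y &
      forall A, G A ->
        (\int[P]_(w in A) (Y w)%:E = \int[P]_(w in A) (X w)%:E)%E].

(* open sets of L^2(G) for the L^2 distance; they are saturated for a.s.
   equality, so that they are the open sets of the quotient space *)
Definition L2_open G (V : set (Omega -> R)) : Prop :=
  V `<=` L2 G /\
  forall X, V X -> exists2 e : R, 0 < e &
    forall Y, L2 G Y -> ('E_P[fun w => ((X w - Y w) ^+ 2)%R] < e%:E)%E -> V Y.

(* measurability on R^I x L^2(G), for the product of the cylindrical
   sigma-algebra of R^I and the Borel sigma-algebra of L^2(G) *)
Definition measurable_path_L2 (I : Type) G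
    (F : (I -> R) -> (Omega -> R) -> R) : Prop :=
  forall U : set R, measurable U ->
    <<s [set x : (I -> R) * (Omega -> R) | L2 G x.2],
        [set C | exists i (A : set R) (V : set (Omega -> R)),
           [/\ measurable A, L2_open G V &
               C = [set x | A (x.1 i) /\ V x.2]]] >>
      [set x | L2 G x.2 /\ U (F x.1 x.2)].

End RandomVariables.

Section Brownian.
Context (R : realType) (disp : measure_display) (Omega : measurableType disp)
  (P : probability Omega R) (d : nat).
Implicit Types (B : R -> Omega -> 'rV[R]_d).

(* standard d-dimensional Brownian motion on [0, T]; the second argument of
   [normal_prob] is the standard deviation *)
Definition is_brownian_motion (T : R) B : Prop :=
  [/\ forall t k, t \in `[0, T] -> measurable_fun setT (fun w => B t w 0 k),
      {ae P, forall w, B 0 w = 0},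
      {ae P, forall w, forall k : 'I_d,
         {within `[0, T], continuous (fun t => B t w 0 k)}},
      forall s t k, 0 <= s -> s < t -> t <= T ->
        forall U : set R, measurable U ->
          P ((fun w => B t w 0 k - B s w 0 k) @^-1` U) =
          normal_prob 0 (Num.sqrt (t - s)) U &
      forall (m : nat) (s : nat -> R),
        0 <= s 0%N -> (forall j, (j < m)%N -> s j <= s j.+1) -> s m <= T ->
        mutually_independent P
          (fun (jk : 'I_m * 'I_d) w =>
             B (s jk.1.+1) w 0 jk.2 - B (s jk.1) w 0 jk.2)].

Definition brownian_filtration B (t : R) : set (set Omega) :=
  <<s [set A | exists s k (U : set R),
         [/\ s \in `[0, t], measurable U & A = (fun w => B s w 0 k) @^-1` U]]
      `|` [set A | P.-negligible A] >>.

Definition step_fun (m : nat) (s : nat -> R) (c : nat -> 'rV[R]_d) (u : R) :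
    'rV[R]_d :=
  \sum_(j < m | s j < u <= s j.+1) c j.

Definition step_integral B (m : nat) (s : nat -> R) (c : nat -> 'rV[R]_d)
    (w : Omega) : R :=
  \sum_(j < m) dot (c j) (B (s j.+1) w - B (s j) w).

(* [I] is a version of the integral of [h] . dB over [0, t], for a
   deterministic square-integrable [h]: the L^2 limit of the integrals of step
   functions approximating [h] in L^2([0, t]; R^d) *)
Definition is_wiener_integral B (t : R) (h : R -> 'rV[R]_d) (I : Omega -> R) :
    Prop :=
  measurable_fun setT I /\
  forall e : R, 0 < e -> exists m (s : nat -> R) (c : nat -> 'rV[R]_d),
    [/\ 0 <= s 0%N, forall j, (j < m)%N -> s j <= s j.+1, s m <= t,
        (\int[lebesgue_measure]_(u in `[0%R, t])
           (enorm (h u - step_fun m s c u) ^+ 2)%:E <= e%:E)%E &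
        ('E_P[fun w => ((I w - step_integral B m s c w) ^+ 2)%R] <= e%:E)%E].

End Brownian.

Section Chaos.
Context (R : realType) (d : nat) (T : R).

Definition L2T (f : R -> 'rV[R]_d) : Prop :=
  (forall k, measurable_fun `[0, T] (fun u => f u 0 k)) /\
  (\int[lebesgue_measure]_(u in `[0%R, T]) (enorm (f u) ^+ 2)%:E < +oo)%E.

Definition is_orthonormal_basis (h : nat -> R -> 'rV[R]_d) : Prop :=
  [/\ forall i, L2T (h i),
      forall i j,
        (\int[lebesgue_measure]_(u in `[0%R, T]) (dot (h i u) (h j u))%:E =
         ((i == j)%:R : R)%:E)%E &
      forall f, L2T f -> forall e : R, 0 < e ->
        exists N (c : nat -> R),
          (\int[lebesgue_measure]_(u in `[0%R, T])
             (enorm (f u - \sum_(i < N) c i *: h i u) ^+ 2)%:E <= e%:E)%E].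

Definition hermite (n : nat) (x : R) : R :=
  (-1) ^+ n / (n`!)%:R * expR (x ^+ 2 / 2) *
  derive1n n (fun y : R => expR (- (y ^+ 2 / 2))) x.

(* The sequences a_1, a_2, ... of the chaos expansion are indexed from 0. *)
Definition mindex := {fsfun nat -> nat with 0%N}.

Definition mlength (a : mindex) : nat := (\sum_(i <- finsupp a) a i)%N.
Definition mfact (a : mindex) : nat := (\prod_(i <- finsupp a) (a i)`!)%N.

Context (disp : measure_display) (Omega : measurableType disp)
  (P : probability Omega R).

(* the value of X_t^a, where [W i t] is the integral of h_i . dB over [0, t] *)
Definition chaos_process (W : nat -> R -> Omega -> R) (t : R) (w : Omega)
    (a : mindex) : R :=
  \prod_(i <- finsupp a) hermite (a i) (W i t w).

Definition chaos_coef (W : nat -> R -> Omega -> R) (xi : Omega -> R)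
    (a : mindex) : R :=
  (mfact a)%:R * fine 'E_P[fun w => xi w * chaos_process W T w a].

(* a_k = 0 for k > M reads a k = 0 for k >= M with indices starting at 0; the
   index set is finite *)
Definition chaos_proj (W : nat -> R -> Omega -> R) (p M : nat)
    (xi : Omega -> R) (w : Omega) : R :=
  \sum_(a \in [set a : mindex | (mlength a <= p)%N /\
                                forall k, (M <= k)%N -> a k = 0%N])
     chaos_coef W xi a * chaos_process W T w a.

End Chaos.

Section Scheme.
Context (R : realType) (disp : measure_display) (Omega : measurableType disp)
  (P : probability Omega R) (d : nat).

Definition is_partition (T : R) (n : nat) (t : nat -> R) : Prop :=
  [/\ t 0%N = 0, t n = T & forall i, (i < n)%N -> t i < t i.+1].

Definition mesh (n : nat) (t : nat -> R) : R :=
  \big[Num.max/0]_(i < n) (t i.+1 - t i).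

Definition lipschitz_at (g : R -> R -> 'rV[R]_d -> R) (L s : R) : Prop :=
  forall y1 z1 y2 z2,
    `|g s y1 z1 - g s y2 z2| <= L * (`|y1 - y2| + enorm (z1 - z2)).

(* (Y_i, Z_i) solves the backward scheme with terminal value [xi] *)
Definition is_scheme (B : R -> Omega -> 'rV[R]_d)
    (g : R -> R -> 'rV[R]_d -> R) (n : nat) (t : nat -> R) (xi : Omega -> R)
    (Y : nat -> Omega -> R) (Z : nat -> Omega -> 'rV[R]_d) : Prop :=
  let F := brownian_filtration P B in
  [/\ {ae P, forall w, Y n w = xi w},
      {ae P, forall w, Z n w = 0},
      forall i, (i <= n)%N -> L2 P (F (t i)) (Y i),
      forall i, (i < n)%N -> exists V : Omega -> 'rV[R]_d,
        (forall k, is_cond_exp P (F (t i))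
           (fun w => Y i.+1 w * (B (t i.+1) w 0 k - B (t i) w 0 k))
           (fun w => V w 0 k)) /\
        {ae P, forall w, Z i w = (t i.+1 - t i)^-1 *: V w} &
      forall i, (i < n)%N -> exists V : Omega -> R,
        is_cond_exp P (F (t i)) (Y i.+1) V /\
        {ae P, forall w,
           Y i w = V w + (t i.+1 - t i) * g (t i) (Y i w) (Z i w)}].

End Scheme.

(* Main.v *)
Require Import Defs.
From mathcomp Require Import all_boot all_order all_algebra finmap.
From mathcomp Require Import all_classical all_reals all_analysis.
From mathcomp Require Import measurable_realfun.
From mathcomp Require Import ring lra.
Set Implicit Arguments.
Unset Strict Implicit.
Unset Printing Implicit Defensive.
Import Order.TTheory GRing.Theory Num.Theory.
Import numFieldNormedType.Exports.
Local Open Scope classical_set_scope.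
Local Open Scope ring_scope.

(* Only two features of the projection [chaos_proj] matter: it is
   F_T-measurable, and if it is not square-integrable the right-hand side is
   +oo. The theorem is then the L^2 stability of the backward scheme with
   respect to its terminal value. For the differences y, z of two solutions and
   m = E_(t_i)[y_(i+1)], Bessel's inequality for the increments of B gives
     E|m|^2 + dt_i / 8 * E|z_i|^2 <= E|y_(i+1)|^2
   with a constant that does not depend on the dimension (8 rather than 1, since
   a crude bound on the second moment of the increments is enough). The
   Lipschitz bound |y_i - m| <= L dt_i (|y_i| + |z_i|) and Young's inequality
   turn this into
     e^(- c dt_i) E|y_i|^2 + dt_i / 16 * E|z_i|^2 <= E|y_(i+1)|^2,
   and a discrete Gronwall argument concludes. *)

(** Conditional expectations enter through [cond_centered]: an integrable function whose integral
    vanishes on every event of G. Two obstacles shape the proof. First, [is_cond_exp] provides only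
    integrability of m and of v_k = E[y DB_k | G], so the cross terms in Bessel's square need not be
    integrable. The indicator of a G-event on which m and v are bounded makes all coefficients
    bounded, and monotone convergence removes it at the end; finiteness of E|z_i|^2 is thus a
    result, not an assumption. Second, independence is given for increments along finite grids,
    while the conditioning is on a filtration generated by values of B and null sets; two pi-lambda
    arguments close this gap. The dimension drops out because the components of an increment are
    conditionally orthogonal, so one bound on each second moment serves them all. The rate c
    contains 1 / (1 - L rho): solving the implicit equation for |y_i| divides by 1 - L dt_i, which
    [rho] keeps away from 0. *)

Section Integrability.
Context (R : realType) (disp : measure_display) (Omega : measurableType disp)
  (P : probability Omega R).
Implicit Types (X Y : Omega -> R) (A : set Omega).

Lemma mulr_norm_le (x y : R) : `|x * y| <= x ^+ 2 + y ^+ 2.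
Proof. by rewrite ler_norml; apply/andP; split; nra. Qed.

Lemma integrable_mul X Y :
  measurable_fun setT X -> measurable_fun setT Y ->
  P.-integrable setT (EFin \o (fun w => X w ^+ 2)) ->
  P.-integrable setT (EFin \o (fun w => Y w ^+ 2)) ->
  P.-integrable setT (EFin \o (fun w => X w * Y w)).
Proof.
move=> mX mY iX iY; apply: le_integrable (integrableD _ iX iY) => //.
  by apply/measurable_EFinP; exact: measurable_funM.
move=> w _; rewrite /= lee_fin.
by rewrite (le_trans (mulr_norm_le _ _))// ger0_norm// addr_ge0// sqr_ge0.
Qed.

Lemma integrable_sqr_integrable X :
  measurable_fun setT X ->
  P.-integrable setT (EFin \o (fun w => X w ^+ 2)) ->
  P.-integrable setT (EFin \o X).
Proof.
move=> mX iX; have -> : EFin \o X = EFin \o (fun w => X w * cst 1 w).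
  by apply/funext => w /=; rewrite mulr1.
apply: integrable_mul => //.
have -> : EFin \o (fun w : Omega => (cst 1 w : R) ^+ 2) = EFin \o cst 1.
  by apply/funext => w /=; rewrite expr1n.
exact: finite_measure_integrable_cst.
Qed.

Lemma integrable_bounded_mul (c : R) X Y :
  measurable_fun setT X -> (forall w, `|X w| <= c) ->
  P.-integrable setT (EFin \o Y) ->
  P.-integrable setT (EFin \o (fun w => X w * Y w)).
Proof.
move=> mX Xc iY.
have mY : measurable_fun setT Y by exact/measurable_EFinP/(measurable_int P).
apply: (le_integrable _ _ _ (integrableZl _ c iY)) => //.
  by apply/measurable_EFinP; exact: measurable_funM.
move=> w _; rewrite /= lee_fin !normrM ler_wpM2r//.
by rewrite (le_trans (Xc w))// ler_norm.
Qed.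

End Integrability.

(** * Functions that integrate to zero on every event of a sigma-algebra *)

Section ZeroIntegral.
Context (R : realType) (disp : measure_display) (Omega : measurableType disp)
  (P : probability Omega R) (G : set (set Omega)).
Hypotheses (sG : sigma_algebra setT G) (mG : G `<=` measurable).
Implicit Types (X Y D f : Omega -> R).

(** Seen as measurability on the space equipped with G, [measurable_wrt] inherits the closure
    properties of measurable functions. *)
Lemma measurable_wrtP X :
  measurable_wrt G X <-> measurable_fun setT (X : g_sigma_algebraType G -> R).
Proof.
split=> [GX _ U mU|mX U mU].
  by rewrite setTI; apply: sub_sigma_algebra; exact: GX.
have := mX measurableT U mU; rewrite setTI.
by rewrite [measurable _](_ : _ = G (X @^-1` U))// /measurable/= sigma_algebra_id.
Qed.

Lemma measurable_wrt_fun X : measurable_wrt G X -> measurable_fun setT X.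
Proof. by move=> GX _ U mU; rewrite setTI; exact/mG/GX. Qed.

Lemma Rintegral_indic_mul f A : measurable A ->
  \int[P]_w (\1_A w * f w) = \int[P]_(w in A) f w.
Proof.
move=> mA; rewrite [RHS]Rintegral_mkcond; apply: eq_Rintegral => w _.
by rewrite patchE indicE; case: ifPn => _; rewrite ?mul1r ?mul0r.
Qed.

(* Splitting off the indicator of [{zeta >= c / 2}], whose contribution
   vanishes, halves the range of [zeta]. *)
Lemma zero_integral_halving D (zeta : Omega -> R) (c : R) (n : nat) :
  P.-integrable setT (EFin \o D) ->
  (forall A, G A -> \int[P]_(w in A) D w = 0) ->
  measurable_wrt G zeta -> (forall w, 0 <= zeta w <= c) ->
  `| \int[P]_w (zeta w * D w) | <= c / 2 ^+ n * \int[P]_w `|D w|.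
Proof.
move=> iD D0; elim: n c zeta => [|n IH] c zeta mz zc.
  have mz' := measurable_wrt_fun mz.
  have zn w : `|zeta w| <= c.
    by case/andP: (zc w) => z0 z1; rewrite ger0_norm.
  have izD := integrable_bounded_mul mz' zn iD.
  rewrite expr0 divr1 (le_trans (le_normr_Rintegral _ izD))//.
  rewrite -RintegralZl//; last exact: integrable_norm.
  apply: le_Rintegral => //.
  - exact: integrable_norm.
  - exact: (integrableZl _ _ (integrable_norm iD)).
  - by move=> w _; rewrite normrM ler_wpM2r.
pose A := zeta @^-1` [set x | c / 2 <= x].
have mI : measurable [set x : R | c / 2 <= x].
  rewrite [X in measurable X](_ : _ = `[c / 2, +oo[%classic)//.
  by apply/seteqP; split=> x /=; rewrite in_itv/= andbT.
have GA : G A by exact: mz.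
have mA := mG GA.
pose z' w := zeta w - c / 2 * \1_A w.
have mz' : measurable_wrt G z'.
  apply/measurable_wrtP; apply: measurable_funB; first exact/measurable_wrtP.
  apply: measurable_funM => //; apply: measurable_indic.
  exact: sub_sigma_algebra.
have z'c w : 0 <= z' w <= c / 2.
  have /andP[z0 z1] := zc w; rewrite /z' indicE.
  case: (boolP (w \in A)) => [/set_mem|wA]; rewrite ?mulr1 ?mulr0.
    by rewrite /A/= => ?; apply/andP; split; lra.
  have : ~ A w by move=> ?; move: wA; rewrite mem_set.
  by rewrite /A/= => /negP; rewrite -ltNge => ?; apply/andP; split; lra.
have -> : \int[P]_w (zeta w * D w) = \int[P]_w (z' w * D w).
  have bz' w : `|z' w| <= c / 2 by case/andP: (z'c w) => ? ?; rewrite ger0_norm.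
  have i1 := integrable_bounded_mul (measurable_wrt_fun mz') bz' iD.
  have b2 w : `|\1_A w : R| <= 1 by rewrite indicE ger0_norm// lern1 leq_b1.
  have m2 : measurable_fun setT (\1_A : Omega -> R) by exact: measurable_indic.
  have i2 := integrable_bounded_mul m2 b2 iD.
  under eq_Rintegral => w _.
    rewrite (_ : _ * _ = z' w * D w + c / 2 * (\1_A w * D w)); last first.
      by rewrite /z'; ring.
    over.
  rewrite RintegralD//; last exact: (integrableZl _ (c / 2) i2).
  by rewrite RintegralZl// Rintegral_indic_mul// D0// mulr0 addr0.
apply: le_trans (IH _ _ mz' z'c) _.
by rewrite exprS invfM [c * (_ * _)]mulrA.
Qed.

(** Adding [c] makes the factor nonnegative and leaves the integral unchanged, as D integrates to
    zero over the whole space. The halving bound then holds for every n, so the integral is 0. *)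
Lemma zero_integral_bounded D (zeta : Omega -> R) (c : R) :
  P.-integrable setT (EFin \o D) ->
  (forall A, G A -> \int[P]_(w in A) D w = 0) ->
  measurable_wrt G zeta -> (forall w, `|zeta w| <= c) ->
  \int[P]_w (zeta w * D w) = 0.
Proof.
move=> iD D0 mz zc.
pose z' w := zeta w + c.
have mz' : measurable_wrt G z'.
  by apply/measurable_wrtP; apply: measurable_funD => //; exact/measurable_wrtP.
have z'c w : 0 <= z' w <= c + c.
  by have := zc w; rewrite ler_norml /z' => /andP[? ?]; apply/andP; split; lra.
have -> : \int[P]_w (zeta w * D w) = \int[P]_w (z' w * D w).
  under [RHS]eq_Rintegral do rewrite mulrDl.
  rewrite RintegralD//.
  - rewrite RintegralZl// D0 ?mulr0 ?addr0//.
    by case: sG => G0 GC _; rewrite -(setD0 setT); exact: GC.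
  - exact: (integrable_bounded_mul (measurable_wrt_fun mz) zc iD).
  - exact: (integrableZl _ c iD).
apply/eqP; rewrite -normr_eq0 eq_le normr_ge0 andbT.
apply/ler_addgt0Pl => e e0; rewrite addr0.
set K := (c + c) * \int[P]_w `|D w|.
have K0 : 0 <= K.
  rewrite mulr_ge0// ?Rintegral_ge0//.
  by case/andP: (z'c point); exact: le_trans.
have H n : `|\int[P]_w (z' w * D w)| <= K / 2 ^+ n.
  by rewrite (le_trans (zero_integral_halving n iD D0 mz' z'c))// /K mulrAC.
(* Any n >= K / e is large enough, since n < 2 ^ n. *)
pose n := (Num.truncn (K / e)).+1.
apply: le_trans (H n) _.
rewrite ler_pdivrMr ?exprn_gt0// mulrC -ler_pdivrMr//.
apply: (@le_trans _ _ n%:R); first exact/ltW/truncnS_gt.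
by rewrite -natrX ler_nat ltnW// ltn_expl.
Qed.

End ZeroIntegral.

(** * Conditionally centered functions *)

Section ConditionallyCentered.
Context (R : realType) (disp : measure_display) (Omega : measurableType disp)
  (P : probability Omega R).
Implicit Types (X Y f zeta : Omega -> R) (G : set (set Omega)).

Definition centered f : Prop :=
  P.-integrable setT (EFin \o f) /\ \int[P]_w f w = 0.

(* E[f | G] = 0 *)
Definition cond_centered G f : Prop :=
  P.-integrable setT (EFin \o f) /\ forall A, G A -> \int[P]_(w in A) f w = 0.

Lemma centeredD X Y :
  centered X -> centered Y -> centered (fun w => X w + Y w).
Proof.
move=> [iX X0] [iY Y0]; split; first exact: (integrableD measurableT iX iY).
by rewrite RintegralD// X0 Y0 addr0.
Qed.

Lemma centered_sum (I : finType) (X : I -> Omega -> R) :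
  (forall i, centered (X i)) -> centered (fun w => \sum_i X i w).
Proof.
move=> cX; suff H (r : seq I) : centered (fun w => \sum_(i <- r) X i w).
  exact: H.
elim: r => [|i r IH].
  have -> : (fun w => \sum_(i <- [::]) X i w) = cst 0.
    by apply/funext => w; rewrite big_nil.
  by split; [exact: finite_measure_integrable_cst|rewrite Rintegral_cst// mul0r].
rewrite (_ : (fun w => _) = (fun w => X i w + \sum_(i <- r) X i w)).
  exact: centeredD.
by apply/funext => w; rewrite big_cons.
Qed.

Lemma cond_exp_centered G X Y : G `<=` measurable ->
  is_cond_exp P G X Y -> cond_centered G (fun w => X w - Y w).
Proof.
move=> mG [iX iY _ XY]; split; first exact: (integrableB measurableT iX iY).
move=> A GA; have mA := mG _ GA.
rewrite RintegralB//; try exact: integrableS (subsetT _) _.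
by rewrite /Rintegral XY// subrr.
Qed.

Lemma cond_centeredB G X Y : G `<=` measurable ->
  cond_centered G X -> cond_centered G Y ->
  cond_centered G (fun w => X w - Y w).
Proof.
move=> mG [iX X0] [iY Y0]; split; first exact: (integrableB measurableT iX iY).
move=> A GA; have mA := mG _ GA.
rewrite RintegralB//; try exact: integrableS (subsetT _) _.
by rewrite X0// Y0// subrr.
Qed.

Lemma cond_centered_bounded G f zeta (c : R) :
  sigma_algebra setT G -> G `<=` measurable ->
  cond_centered G f -> measurable_wrt G zeta -> (forall w, `|zeta w| <= c) ->
  centered (fun w => zeta w * f w).
Proof.
move=> sG mG [fi f0] mz zc; split.
  exact: integrable_bounded_mul (measurable_wrt_fun mG mz) zc fi.
exact: (zero_integral_bounded sG mG fi f0 mz zc).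
Qed.

Lemma measurable_norm_le G X (N : R) : sigma_algebra setT G ->
  measurable_wrt G X -> G [set w | `|X w| <= N].
Proof.
move=> sG mX; have mU : measurable [set x : R | `|x| <= N].
  rewrite [X in measurable X](_ : _ = `[- N, N]%classic)//.
  by apply/seteqP; split=> x /=; rewrite in_itv/= ler_norml.
exact: mX mU.
Qed.

(** Truncating the possibly unbounded [zeta] on the G-events {|zeta| <= n} reduces to the bounded
    case; |zeta f| dominates the truncated products. *)
Lemma cond_centered_mul G f zeta :
  sigma_algebra setT G -> G `<=` measurable ->
  cond_centered G f -> measurable_wrt G zeta ->
  P.-integrable setT (EFin \o (fun w => zeta w * f w)) ->
  centered (fun w => zeta w * f w).
Proof.
move=> sG mG cf mz izf; split=> //.
pose A n := [set w | `|zeta w| <= n%:R].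
have GA n : G (A n) by exact: measurable_norm_le.
pose fn n w := \1_(A n) w * (zeta w * f w).
have fn0 n : \int[P]_w fn n w = 0.
  rewrite (_ : fn n = fun w => (\1_(A n) w * zeta w) * f w); last first.
    by apply/funext => w; rewrite /fn mulrA.
  apply: (cond_centered_bounded (c := n%:R) sG mG cf _ _).2.
    apply/(measurable_wrtP sG); apply: measurable_funM => //.
      by apply: measurable_indic; exact: sub_sigma_algebra.
    exact/(measurable_wrtP sG).
  move=> w; rewrite indicE; case: (boolP (w \in A n)) => [/set_mem|_].
    by rewrite mul1r.
  by rewrite mul0r normr0.
have mzf : measurable_fun setT (fun w => zeta w * f w).
  exact/measurable_EFinP/(measurable_int P).
have cvg := @dominated_convergence _ _ _ P setT measurableT
  (fun n w => (fn n w)%:E) (fun w => (zeta w * f w)%:E)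
  (fun w => `|zeta w * f w|%:E).
have [||||_ _] := cvg _ _ _ (integrable_norm izf) _.
- move=> n; apply/measurable_EFinP; apply: measurable_funM => //.
  by apply: measurable_indic; exact/mG.
- exact/measurable_EFinP.
- apply: aeW => w _; apply: cvg_EFin.
    by apply: nearW.
  (* At a fixed w the truncated product is stationary once n exceeds |zeta w|. *)
  apply: cvg_near_cst; exists (Num.truncn `|zeta w|).+1 => // n /= nz.
  rewrite /fn indicE mem_set ?mul1r// /A/=.
  by rewrite (le_trans (ltW (truncnS_gt _)))// ler_nat.
- apply: aeW => w n _; rewrite /= lee_fin /fn normrM.
  by rewrite ler_piMl// indicE ger0_norm// lern1 leq_b1.
rewrite (_ : (fun n => _) = cst 0%E); last first.
  apply/funext => n; rewrite -[LHS]fineK//; last first.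
    apply: integrable_fin_num => //.
    apply: (le_integrable _ _ _ izf) => //.
      apply/measurable_EFinP; apply: measurable_funM => //.
      by apply: measurable_indic; exact/mG.
    move=> w _; rewrite /= lee_fin /fn normrM.
    by rewrite ler_piMl// indicE ger0_norm// lern1 leq_b1.
  by congr EFin; exact: fn0.
move=> /cvg_lim; rewrite lim_cst// /Rintegral => <-//.
Qed.

End ConditionallyCentered.

(** * Conditional Bessel inequality *)

Section Bessel.
Context (R : realType) (disp : measure_display) (Omega : measurableType disp)
  (P : probability Omega R).

(* The residual [y - m - kappa^-1 * sum_k v k * D k] of the projection of [y],
   cut off where [m] and [v] are large, has a nonnegative second moment; all
   the cross terms of its square vanish. *)
Lemma cond_bessel (G : set (set Omega)) (d : nat) (y m : Omega -> R)
    (v D : 'I_d -> Omega -> R) (s : 'I_d -> R) (kappa : R) :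
  sigma_algebra setT G -> G `<=` measurable ->
  0 < kappa -> (forall k, s k <= kappa) ->
  P.-integrable setT (EFin \o (fun w => y w ^+ 2)) ->
  measurable_wrt G m -> (forall k, measurable_wrt G (v k)) ->
  cond_centered P G (fun w => y w - m w) ->
  (forall k, cond_centered P G (fun w => y w * D k w - v k w)) ->
  (forall k, cond_centered P G (D k)) ->
  (forall k l, cond_centered P G (fun w => D k w * D l w - (k == l)%:R * s k)) ->
  (\int[P]_w (m w ^+ 2 + kappa^-1 * \sum_k v k w ^+ 2)%:E <=
   \int[P]_w (y w ^+ 2)%:E)%E.
Proof.
move=> sG mG k0 sk iy mm mv cm cv cD cDD.
have mm' := measurable_wrt_fun mG mm.
have mv' k := measurable_wrt_fun mG (mv k).
pose H w := m w ^+ 2 + kappa^-1 * \sum_k v k w ^+ 2.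
have mH : measurable_fun setT H.
  apply: measurable_funD; first exact: measurable_funX.
  apply: measurable_funM => //.
  by apply: measurable_sum => k; exact: measurable_funX.
have H0 w : 0 <= H w.
  rewrite addr_ge0 ?sqr_ge0// mulr_ge0// ?invr_ge0 ?(ltW k0)// sumr_ge0// => k _.
  by rewrite sqr_ge0.
(* The cutoff events belong to G, as finite intersections, and increase to the whole space. *)
pose A n := [set w | `|m w| <= n%:R] `&`
  \bigcap_(k in [set: 'I_d]) [set w | `|v k w| <= n%:R].
have GA n : G (A n).
  pose T' := g_sigma_algebraType G.
  rewrite -(sigma_algebra_id sG); apply: (@measurableI _ T').
    by apply: sub_sigma_algebra; exact: measurable_norm_le.
  apply: (@fin_bigcap_measurable _ T') => // k _.
  by apply: sub_sigma_algebra; exact: measurable_norm_le.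
have mA n := mG _ (GA n).
have main n : (\int[P]_(w in A n) (H w)%:E <= \int[P]_w (y w ^+ 2)%:E)%E.
  pose a w : R := \1_(A n) w.
  have a01 w : a w = 0 \/ a w = 1.
    by rewrite /a indicE; case: (w \in A n); [right|left].
  have am w : `|a w * m w| <= n%:R.
    rewrite /a indicE; case: (boolP (w \in A n)) => [/set_mem[wm _]|_].
      by rewrite mul1r.
    by rewrite mul0r normr0.
  have av k w : `|a w * v k w| <= n%:R.
    rewrite /a indicE; case: (boolP (w \in A n)) => [/set_mem[_ wv]|_].
      by rewrite mul1r; exact: wv.
    by rewrite mul0r normr0.
  have aa w : a w * a w = a w by case: (a01 w) => ->; rewrite ?mulr0 ?mulr1.
  have wrtM (X Y : Omega -> R) : measurable_wrt G X -> measurable_wrt G Y ->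
      measurable_wrt G (fun w => X w * Y w).
    move=> mX mY; apply/(measurable_wrtP sG).
    by apply: measurable_funM; exact/(measurable_wrtP sG).
  have ma : measurable_wrt G a.
    apply/(measurable_wrtP sG); apply: measurable_indic.
    exact: sub_sigma_algebra.
  have wrtZ (c : R) (X : Omega -> R) : measurable_wrt G X -> measurable_wrt G (fun w => c * X w).
    move=> mX; have mc : measurable_wrt G (cst c : Omega -> R).
      by apply/(measurable_wrtP sG); exact: measurable_cst.
    exact: (wrtM (cst c) X).
  have c0 : 0 <= 2 * kappa^-1 by rewrite mulr_ge0// invr_ge0 ltW.
  (* Each of [W1], ..., [W4] is a piece of the expanded square minus its conditional expectation,
     written as a bounded G-measurable factor times a conditionally centered one. *)
  pose W1 w := (- 2 * (a w * m w)) * (y w - m w).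
  have cW1 : centered P W1.
    apply: (cond_centered_bounded (c := 2 * n%:R) sG mG cm).
      by apply: wrtZ; exact: wrtM.
    by move=> w; rewrite normrM normrN (ger0_norm (ler0n _ 2)) ler_wpM2l.
  pose W2 k w := (- (2 * kappa^-1) * (a w * v k w)) * (y w * D k w - v k w).
  have cW2 k : centered P (W2 k).
    apply: (cond_centered_bounded (c := 2 * kappa^-1 * n%:R) sG mG (cv k)).
      by apply: wrtZ; exact: wrtM.
    by move=> w; rewrite normrM normrN (ger0_norm c0) ler_wpM2l.
  pose W3 k w := (2 * kappa^-1 * ((a w * m w) * (a w * v k w))) * D k w.
  have cW3 k : centered P (W3 k).
    apply: (cond_centered_bounded (c := 2 * kappa^-1 * (n%:R * n%:R)) sG mG (cD k)).
      by apply/wrtZ/wrtM; exact: wrtM.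
    by move=> w; rewrite normrM (ger0_norm c0) ler_wpM2l// normrM ler_pM.
  pose W4 k l w := (kappa^-1 ^+ 2 * ((a w * v k w) * (a w * v l w))) *
    (D k w * D l w - (k == l)%:R * s k).
  have cW4 k l : centered P (W4 k l).
    apply: (cond_centered_bounded (c := kappa^-1 ^+ 2 * (n%:R * n%:R)) sG mG (cDD k l)).
      by apply/wrtZ/wrtM; exact: wrtM.
    move=> w; rewrite normrM ger0_norm ?sqr_ge0//.
    rewrite ler_wpM2l ?sqr_ge0//.
    by rewrite normrM ler_pM.
  pose W w := W1 w + (\sum_k W2 k w + (\sum_k W3 k w + \sum_k \sum_l W4 k l w)).
  have [iW W0] : centered P W.
    apply: centeredD => //; apply: centeredD; first exact: centered_sum.
    apply: centeredD; first exact: centered_sum.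
    by apply: centered_sum => k; exact: centered_sum.
  (* The right side exceeds the left by [a] times the squared residual plus kappa^-2 (kappa sum
     v_k^2 - sum s_k v_k^2), which is nonnegative because s_k <= kappa. *)
  have key w : a w * H w <= a w * y w ^+ 2 + W w.
    pose S := \sum_k v k w * D k w.
    pose V2 := \sum_k v k w ^+ 2.
    pose SV := \sum_k s k * v k w ^+ 2.
    have E2 : \sum_k W2 k w = - (2 * kappa^-1) * a w * (y w * S - V2).
      rewrite /S /V2 mulr_sumr -sumrB mulr_sumr; apply: eq_bigr => k _.
      by rewrite /W2; ring.
    have E3 : \sum_k W3 k w = 2 * kappa^-1 * a w * m w * S.
      rewrite /S mulr_sumr; apply: eq_bigr => k _; rewrite /W3.
      by rewrite -[in RHS](aa w); ring.
    have E4 : \sum_k \sum_l W4 k l w = kappa^-1 ^+ 2 * a w * (S ^+ 2 - SV).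
      rewrite [S ^+ 2]expr2 /S /SV big_distrlr/= -sumrB mulr_sumr.
      apply: eq_bigr => k _.
      (* The diagonal sum becomes a double sum with a Kronecker factor, to match [W4] term by
         term. *)
      rewrite -[X in _ = _ * (_ - X)]mul1r.
      rewrite (_ : 1 * (s k * v k w ^+ 2) =
          \sum_l (k == l)%:R * (s k * v k w * v l w)); last first.
        rewrite (bigD1 k)//= eqxx !mul1r big1 ?addr0; first by ring.
        by move=> l lk; rewrite eq_sym (negbTE lk) mul0r.
      rewrite -sumrB mulr_sumr; apply: eq_bigr => l _.
      by rewrite /W4 -[in RHS](aa w); ring.
    have SVk : SV <= kappa * V2.
      by rewrite /SV /V2 mulr_sumr ler_sum// => k _; rewrite ler_wpM2r ?sqr_ge0.
    rewrite /W E2 E3 E4 /W1 /H -/V2.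
    case: (a01 w) => ->; rewrite ?(mul0r, mul1r, mulr0, mulr1, addr0)//.
    rewrite -subr_ge0.
    have -> : y w ^+ 2 + (-2 * m w * (y w - m w) +
       (- (2 / kappa) * (y w * S - V2) +
        (2 / kappa * m w * S + kappa^-1 ^+ 2 * (S ^+ 2 - SV)))) -
       (m w ^+ 2 + kappa^-1 * V2) =
       (y w - m w - kappa^-1 * S) ^+ 2 + kappa^-1 ^+ 2 * (kappa * V2 - SV).
      by field; rewrite gt_eqF.
    by rewrite addr_ge0 ?sqr_ge0// mulr_ge0 ?sqr_ge0// subr_ge0.
  have iay : P.-integrable setT (EFin \o (fun w => a w * y w ^+ 2)).
    apply: (integrable_bounded_mul (c := 1)) => //.
      exact: measurable_indic.
    by move=> w; case: (a01 w) => ->; rewrite ?normr0 ?normr1.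
  have mH' := measurable_fun setT H.
  have -> : (\int[P]_(w in A n) (H w)%:E = \int[P]_w (a w * H w)%:E)%E.
    rewrite integral_mkcond; apply: eq_integral => w _.
    by rewrite patchE /a indicE; case: ifPn; rewrite ?mul1r ?mul0r.
  apply: (@le_trans _ _ (\int[P]_w (a w * y w ^+ 2 + W w)%:E)%E).
    apply: ge0_le_integral => //.
    - by move=> w _; rewrite lee_fin mulr_ge0// /a indicE.
    - by apply/measurable_EFinP/measurable_funM => //; exact: measurable_indic.
    - apply/measurable_EFinP/measurable_funD; first exact/measurable_EFinP/(measurable_int P).
      exact/measurable_EFinP/(measurable_int P).
    - by move=> w _; rewrite lee_fin.
  rewrite (_ : \int[P]_w (a w * y w ^+ 2 + W w)%:E =
     \int[P]_w (a w * y w ^+ 2)%:E + \int[P]_w (W w)%:E)%E; last first.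
    by rewrite -integralD_EFin.
  have -> : (\int[P]_w (W w)%:E = 0)%E.
    by rewrite -[LHS]fineK ?integrable_fin_num//; congr EFin; exact: W0.
  rewrite adde0; apply: ge0_le_integral => //.
  - by move=> w _; rewrite lee_fin mulr_ge0 ?sqr_ge0// /a indicE.
  - exact: (measurable_int P).
  - exact: (measurable_int P).
  - move=> w _; rewrite lee_fin; case: (a01 w) => ->; rewrite ?mul1r ?mul0r//.
    by rewrite sqr_ge0.
have ndA : nondecreasing_seq A.
  move=> n1 n2 n12; apply/subsetPset => w [wm wv]; split.
    by rewrite /= (le_trans wm)// ler_nat.
  by move=> k _; rewrite /= (le_trans (wv k _))// ler_nat.
have UA : \bigcup_n A n = setT.
  apply/seteqP; split=> // w _.
  pose c := `|m w| + \sum_k `|v k w|.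
  exists (Num.truncn c).+1 => //.
  have ct : c <= (Num.truncn c).+1%:R by exact/ltW/truncnS_gt.
  split=> [|k _]; rewrite /= (le_trans _ ct)//.
    by rewrite lerDl sumr_ge0.
  rewrite /c (bigD1 k)//= addrCA lerDl addr_ge0// sumr_ge0//.
have := @ge0_nondecreasing_set_cvg_integral _ _ _ A (fun w => (H w)%:E) P ndA mA.
rewrite UA => cvgA.
have {}cvgA := cvgA _ _.
have {cvgA} := cvgA (fun i => measurable_funTS ((measurable_EFinP _ _).2 mH))
  (fun i w _ => ltac:(by rewrite lee_fin)).
move=> cvgA; rewrite -(cvg_lim _ cvgA)//.
apply: lime_le; first by apply/cvg_ex; eexists; exact: cvgA.
by apply: nearW => n; exact: main.
Qed.

End Bessel.

(** * First two moments of a centered normal variable *)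

Section NormalMoments.
Context (R : realType).
Implicit Types (sigma x : R).
Local Notation mu := (@lebesgue_measure R).

(** The Radon-Nikodym derivative of [normal_prob] and the explicit density have the same integral on
    every measurable set, hence agree a.e. *)
Lemma integral_normal_prob sigma (f : R -> \bar R) :
  measurable_fun setT f -> (forall x, (0 <= f x)%E) ->
  (\int[normal_prob 0 sigma]_x f x =
   \int[mu]_x (f x * (normal_pdf 0 sigma x)%:E))%E.
Proof.
move=> mf f0; have dom := normal_prob_dominates (0 : R) sigma.
rewrite -(Radon_Nikodym_SigmaFinite.change_of_variables dom)//.
have iRN := Radon_Nikodym_SigmaFinite.f_integrable dom.
have mpdf : measurable_fun setT (EFin \o normal_pdf 0 sigma).
  by apply/measurable_EFinP; exact: measurable_normal_pdf.
apply: ae_eq_integral => //.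
- by apply: emeasurable_funM => //; exact: (measurable_int mu).
- exact: emeasurable_funM.
- apply: ae_eqe_mul2l; apply: integral_ae_eq => // E _ mE.
  by rewrite -Radon_Nikodym_SigmaFinite.f_integral.
Qed.

Lemma normal_pdfN sigma x : sigma != 0 ->
  normal_pdf 0 sigma (- x) = normal_pdf 0 sigma x.
Proof. by move=> s0; rewrite !normal_pdfE// /normal_fun !subr0 sqrrN. Qed.

(** Trades the factor x^2 for a doubled standard deviation, so that the second moment is bounded by
    the mass of another normal law. With u = x^2 / (4 sigma^2) it reduces to u e^(-u) <= e^(u/2);
    the 8 is this 4 times the 2 lost in the peak. *)
Lemma sqr_normal_pdf_le sigma x : 0 < sigma ->
  x ^+ 2 * normal_pdf 0 sigma x <=
  8 * sigma ^+ 2 * normal_pdf 0 (2 * sigma) x.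
Proof.
move=> s0; rewrite !normal_pdfE ?gt_eqF// ?mulr_gt0//.
rewrite /normal_fun !subr0.
have -> : normal_peak (2 * sigma) = normal_peak sigma / 2.
  rewrite /normal_peak.
  have -> : (2 * sigma) ^+ 2 * pi *+ 2 = 2 ^+ 2 * (sigma ^+ 2 * pi *+ 2).
    by rewrite exprMn -mulrA mulrnAr.
  by rewrite sqrtrM ?sqr_ge0// sqrtr_sqr normr_nat invfM mulrC.
set u := x ^+ 2 / (4 * sigma ^+ 2).
have -> : - x ^+ 2 / (sigma ^+ 2 *+ 2) = - u + - u.
  by rewrite /u -mulr_natr; field; rewrite gt_eqF.
have -> : - x ^+ 2 / ((2 * sigma) ^+ 2 *+ 2) = - u + u / 2.
  by rewrite /u -mulr_natr; field; rewrite gt_eqF.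
have u0 : 0 <= u by rewrite divr_ge0 ?sqr_ge0// mulr_ge0// sqr_ge0.
have -> : x ^+ 2 = 4 * sigma ^+ 2 * u.
  by rewrite /u; field; rewrite gt_eqF.
rewrite !expRD.
have peak0 := normal_peak_ge0 sigma.
have ue : u * expR (- u) <= expR (u / 2).
  rewrite expRN ler_pdivrMr ?expR_gt0//.
  apply: (@le_trans _ _ (expR u)).
    by rewrite (le_trans _ (expR_ge1Dx u))// lerDr.
  by rewrite ler_peMl ?expR_ge0// -expR0 ler_expR divr_ge0.
have -> : 4 * sigma ^+ 2 * u * (normal_peak sigma * (expR (- u) * expR (- u))) =
  4 * sigma ^+ 2 * normal_peak sigma * expR (- u) * (u * expR (- u)) by ring.
have -> : 8 * sigma ^+ 2 * (normal_peak sigma / 2 * (expR (- u) * expR (u / 2))) =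
  4 * sigma ^+ 2 * normal_peak sigma * expR (- u) * expR (u / 2) by field.
by rewrite ler_wpM2l// mulr_ge0 ?expR_ge0// mulr_ge0// mulr_ge0// sqr_ge0.
Qed.

Lemma normal_prob_sqr_le sigma : 0 < sigma ->
  (\int[normal_prob 0 sigma]_x (x ^+ 2)%:E <= (8 * sigma ^+ 2)%:E)%E.
Proof.
move=> s0; rewrite integral_normal_prob; last 2 first.
- by apply/measurable_EFinP; exact: measurable_funX.
- by move=> x; rewrite lee_fin sqr_ge0.
have s8 : 0 <= 8 * sigma ^+ 2 by rewrite mulr_ge0// sqr_ge0.
apply: (@le_trans _ _
  (\int[mu]_x ((8 * sigma ^+ 2)%:E * (normal_pdf 0 (2 * sigma) x)%:E))%E).
  apply: ge0_le_integral => //.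
  - by move=> x _; rewrite -EFinM lee_fin mulr_ge0 ?sqr_ge0// normal_pdf_ge0.
  - apply/measurable_EFinP/measurable_funM; first exact: measurable_funX.
    exact: measurable_normal_pdf.
  - apply/measurable_EFinP/measurable_funM => //.
    exact: measurable_normal_pdf.
  - by move=> x _; rewrite -!EFinM lee_fin sqr_normal_pdf_le.
rewrite ge0_integralZl//.
- by rewrite integral_normal_pdf mule1.
- by apply/measurable_EFinP; exact: measurable_normal_pdf.
- by move=> x _; rewrite lee_fin normal_pdf_ge0.
Qed.

Lemma ge0_integralN (f : R -> \bar R) :
  measurable_fun setT f -> (forall x, (0 <= f x)%E) ->
  (\int[mu]_x f (- x)%R = \int[mu]_x f x)%E.
Proof.
move=> mf f0.
transitivity (\int[pushforward mu (-%R : _ -> measurableTypeR R)]_x f x)%E.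
  by rewrite ge0_integral_pushforward.
by apply: eq_measure_integral => A mA _; exact: lebesgue_measureN.
Qed.

(** Symmetry is phrased with positive and negative parts because their integrals make sense before
    any integrability is known. *)
Lemma normal_prob_posneg sigma : sigma != 0 ->
  (\int[normal_prob 0 sigma]_x (Num.max x 0)%:E =
   \int[normal_prob 0 sigma]_x (Num.max (- x) 0)%:E)%E.
Proof.
move=> s0.
have mmax : measurable_fun setT (fun x : R => Num.max x 0).
  exact: measurable_maxr.
have mmaxN : measurable_fun setT (fun x : R => Num.max (- x) 0).
  by apply: measurable_maxr => //; exact: oppr_measurable.
rewrite !integral_normal_prob.
- rewrite -ge0_integralN.
  + by apply: eq_integral => x _; rewrite normal_pdfN.
  + apply/measurable_EFinP/measurable_funM => //.
    exact: measurable_normal_pdf.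
  + move=> x; rewrite -EFinM lee_fin mulr_ge0 ?normal_pdf_ge0//.
    by rewrite le_max lexx orbT.
- exact/measurable_EFinP.
- by move=> x; rewrite lee_fin le_max lexx orbT.
- exact/measurable_EFinP.
- by move=> x; rewrite lee_fin le_max lexx orbT.
Qed.

Context (disp : measure_display) (Omega : measurableType disp)
  (P : probability Omega R).

Lemma normal_rv (X : Omega -> R) sigma : 0 < sigma ->
  measurable_fun setT X ->
  (forall U, measurable U -> P (X @^-1` U) = normal_prob 0 sigma U) ->
  [/\ P.-integrable setT (EFin \o (fun w => X w ^+ 2)), \int[P]_w X w = 0 &
      \int[P]_w (X w ^+ 2) <= 8 * sigma ^+ 2].
Proof.
move=> s0 mX lawX.
have transfer (f : R -> \bar R) : measurable_fun setT f ->
    (forall x, (0 <= f x)%E) ->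
    (\int[P]_w f (X w) = \int[normal_prob 0 sigma]_x f x)%E.
  move=> mf f0.
  transitivity (\int[pushforward P (X : _ -> measurableTypeR R)]_x f x)%E.
    by rewrite ge0_integral_pushforward.
  by apply: eq_measure_integral => A mA _; exact: lawX.
have sq : (\int[P]_w (X w ^+ 2)%:E <= (8 * sigma ^+ 2)%:E)%E.
  rewrite (transfer (fun x => (x ^+ 2)%:E)).
  - exact: normal_prob_sqr_le.
  - by apply/measurable_EFinP; exact: measurable_funX.
  - by move=> x; rewrite lee_fin sqr_ge0.
have iX2 : P.-integrable setT (EFin \o (fun w => X w ^+ 2)).
  apply/integrableP; split.
    by apply/measurable_EFinP; exact: measurable_funX.
  apply: le_lt_trans (ltry (8 * sigma ^+ 2)); apply: le_trans sq.
  by under eq_integral do rewrite /= ger0_norm ?sqr_ge0//.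
split=> //; last first.
  by rewrite -lee_fin fineK//; exact: integrable_fin_num.
rewrite /Rintegral integralE.
have -> : (\int[P]_w (fun w => (X w)%:E)^\+ w = \int[P]_w (Num.max (X w) 0)%:E)%E.
  by apply: eq_integral => w _; rewrite funeposE -EFin_max.
have -> : (\int[P]_w (fun w => (X w)%:E)^\- w = \int[P]_w (Num.max (- X w) 0)%:E)%E.
  by apply: eq_integral => w _; rewrite funenegE -EFinN -EFin_max.
rewrite (transfer (fun x => (Num.max x 0)%:E)); last 2 first.
- by apply/measurable_EFinP; exact: measurable_maxr.
- by move=> x; rewrite lee_fin le_max lexx orbT.
rewrite (transfer (fun x => (Num.max (- x) 0)%:E)); last 2 first.
- by apply/measurable_EFinP/measurable_maxr => //; exact: oppr_measurable.
- by move=> x; rewrite lee_fin le_max lexx orbT.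
rewrite normal_prob_posneg ?gt_eqF//.
(* Both parts have the same integral; were it infinite, [fine] of the difference would still be 0 by
   convention. *)
by case: (\int[_]_x _)%E => [r| |] //=; rewrite subrr.
Qed.

End NormalMoments.

(** * From independence of events to vanishing integrals *)

Section Independence.
Context (R : realType) (disp : measure_display) (Omega : measurableType disp)
  (P : probability Omega R).
Implicit Types (X Y f : Omega -> R) (A : set Omega).

Let preimages X : set (set Omega) := preimage_set_system setT X measurable.

Let sigma_preimages X : sigma_algebra setT (preimages X).
Proof. by apply: sigma_algebra_preimage; exact: sigma_algebra_measurable. Qed.

Let preimages_measurable X : measurable_fun setT X ->
  preimages X `<=` measurable.
Proof. by move=> mX _ [U mU <-]; exact: mX. Qed.

Let measurable_wrt_preimages X : measurable_wrt (preimages X) X.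
Proof. by move=> U mU; exists U => //; rewrite setTI. Qed.

(** This is [cond_centered_mul] for the sigma-algebra generated by [X]. *)
Lemma Rintegral_mul_eq0 X Y :
  measurable_fun setT X -> P.-integrable setT (EFin \o Y) ->
  (forall U, measurable U -> \int[P]_(w in X @^-1` U) Y w = 0) ->
  P.-integrable setT (EFin \o (fun w => X w * Y w)) ->
  \int[P]_w (X w * Y w) = 0.
Proof.
move=> mX iY Y0 iXY.
apply: (@cond_centered_mul _ _ _ P (preimages X) Y X _ _ _ _ iXY).2 => //.
- exact: preimages_measurable.
- by split=> // _ [U mU <-]; rewrite setTI; exact: Y0.
Qed.

(** The roles are exchanged: by independence 1_A - P(A) integrates to zero on every event {Y in V},
    so its product with Y has integral zero. No approximation of Y by simple functions is
    involved. *)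
Lemma Rintegral_indep_event A Y : measurable A ->
  P.-integrable setT (EFin \o Y) ->
  (forall V, measurable V ->
     P (A `&` Y @^-1` V) = (P A * P (Y @^-1` V))%E) ->
  \int[P]_(w in A) Y w = fine (P A) * \int[P]_w Y w.
Proof.
move=> mA iY indep.
have mY : measurable_fun setT Y by exact/measurable_EFinP/(measurable_int P).
have mV V : measurable V -> measurable (Y @^-1` V).
  by move=> mV; rewrite -(setTI (_ @^-1` _)); exact: mY.
have m1 : measurable_fun setT (\1_A : Omega -> R) by exact: measurable_indic.
have b1 w : `|\1_A w : R| <= 1 by rewrite indicE ger0_norm// lern1 leq_b1.
have i1 : P.-integrable setT (EFin \o (\1_A : Omega -> R)).
  exact: integrable_indic.
pose p := fine (P A).
have ip : P.-integrable setT (EFin \o (fun=> p)).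
  exact: finite_measure_integrable_cst.
have i1Y := integrable_bounded_mul m1 b1 iY.
have ipY : P.-integrable setT (EFin \o (fun w => p * Y w)).
  exact: (integrableZl _ p iY).
apply/eqP; rewrite -subr_eq0; apply/eqP.
rewrite -(Rintegral_indic_mul _ _ mA) -RintegralZl// -RintegralB//.
under eq_Rintegral do rewrite -mulrBl mulrC.
apply: Rintegral_mul_eq0 => //.
- exact: (integrableB measurableT i1 ip).
- move=> V mV'; have mYV := mV V mV'.
  rewrite RintegralB//; try exact: integrableS (subsetT _) _.
  rewrite Rintegral_cst// /Rintegral integral_indic//. rewrite [X in fine X - _](indep V mV').
  by rewrite fineM ?fin_num_measure ?subrr//; exact: mV.
- rewrite (_ : (fun w => _) = (fun w => \1_A w * Y w - p * Y w)).
    exact: (integrableB measurableT i1Y ipY).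
  by apply/funext => w; rewrite -mulrBl mulrC.
Qed.

(** Measurable sets over which f integrates to zero form a Dynkin system; the vanishing total
    integral gives stability under complement. *)
Lemma zero_Rintegral_dynkin (C : set (set Omega)) f :
  C `<=` measurable -> setI_closed C ->
  P.-integrable setT (EFin \o f) -> \int[P]_w f w = 0 ->
  (forall A, C A -> \int[P]_(w in A) f w = 0) ->
  forall A, <<s C >> A -> measurable A /\ \int[P]_(w in A) f w = 0.
Proof.
move=> mC CI fi f0 fC.
have fiA A : measurable A -> P.-integrable A (EFin \o f).
  by move=> mA; exact: integrableS (subsetT _) _.
apply: lambda_system_subset => //; last first.
  by move=> A CA; split; [exact: mC|exact: fC].
apply/dynkin_lambda_system; split => //.
- move=> A [mA fA]; split; first exact: measurableC.
  have := f0; rewrite -(setUv A) Rintegral_setU//.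
  + by rewrite fA add0r.
  + exact: measurableC.
  + by apply: fiA; rewrite setUv.
  + by apply/disj_setPS; rewrite setICr.
- move=> F tF mF; have mF1 n : measurable (F n) by have [] := mF n.
  split; first exact: bigcupT_measurable.
  rewrite /Rintegral integral_bigcup//; last by apply: fiA; exact: bigcupT_measurable.
  rewrite eseries0// => n _ _.
  have [_ fn] := mF n; rewrite -[LHS]fineK ?fin_num_fun//.
    by congr EFin; exact: fn.
  by apply: integrable_fin_num => //; exact: fiA.
Qed.

End Independence.

(** * The next Brownian increment and boxes of past increments *)

Section BrownianIncrements.
Context (R : realType) (disp : measure_display) (Omega : measurableType disp)
  (P : probability Omega R) (d : nat) (T : R) (B : R -> Omega -> 'rV[R]_d).
Hypothesis hB : is_brownian_motion P T B.

Definition incr (s : nat -> R) (j : nat) (k : 'I_d) (w : Omega) : R :=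
  B (s j.+1) w 0 k - B (s j) w 0 k.

Definition rect (m : nat) (s : nat -> R) (U : nat -> 'I_d -> set R) : set Omega :=
  \bigcap_(i in [set: 'I_m * 'I_d]) incr s i.1 i.2 @^-1` U i.1 i.2.

Definition subdivision (m : nat) (s : nat -> R) (u : R) : Prop :=
  [/\ 0 <= s 0%N, forall j, (j < m)%N -> s j <= s j.+1 & s m = u].

Lemma subdivision_le m s u j : subdivision m s u -> (j <= m)%N ->
  0 <= s j <= u.
Proof.
move=> [s0 sS <-] jm; have H i j' : (i <= j' <= m)%N -> s i <= s j'.
  elim: j' => [|j' IH]; first by rewrite leqn0 => /andP[/eqP->].
  rewrite leq_eqVlt => /andP[/orP[/eqP->//|ij jm']].
  by rewrite (le_trans (IH _) (sS _ _))// -ltnS ij ltnW.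
by rewrite (le_trans s0) ?H ?jm ?leqnn.
Qed.

Lemma measurable_B t k : 0 <= t <= T -> measurable_fun setT (fun w => B t w 0 k).
Proof. by have [mB _ _ _ _] := hB => tT; apply: mB; rewrite in_itv. Qed.

Lemma measurable_incr m s u j k : subdivision m s u -> u <= T -> (j < m)%N ->
  measurable_fun setT (incr s j k).
Proof.
move=> hs uT jm; have sT i : (i <= m)%N -> 0 <= s i <= T.
  by move=> /(subdivision_le hs)/andP[-> /le_trans->].
by apply: measurable_funB; apply: measurable_B; apply: sT => //; exact: ltnW.
Qed.

Lemma measurable_rect m s u U : subdivision m s u -> u <= T ->
  (forall j k, measurable (U j k)) -> measurable (rect m s U).
Proof.
move=> hs uT mU; apply: fin_bigcap_measurable => //= -[j k] _ /=.
rewrite -(setTI (_ @^-1` _)).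
exact: (measurable_incr k hs uT (ltn_ord j)).
Qed.

Lemma rect_prob m s u U : subdivision m s u -> u <= T ->
  (forall j k, measurable (U j k)) ->
  P (rect m s U) = (\prod_(j < m) \prod_(k < d) P (incr s j k @^-1` U j k))%E.
Proof.
move=> [s0 sS smu] uT mU; have [_ _ _ _ indep] := hB.
rewrite (indep m s _ _ _ (fun i => U i.1 i.2))//; last by rewrite smu.
by rewrite pair_big.
Qed.

Section Next.
Variables (t0 t1 : R).
Hypotheses (t01 : t0 < t1) (t1T : t1 <= T).
Let D k w := B t1 w 0 k - B t0 w 0 k.

(** Once [t1] is appended to the grid, D is its last increment, and independence along the longer
    grid separates it from the box. *)
Lemma rect_next m s U (V : 'I_d -> set R) : subdivision m s t0 ->
  (forall j k, measurable (U j k)) -> (forall k, measurable (V k)) ->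
  P (rect m s U `&` \bigcap_(k in [set: 'I_d]) D k @^-1` V k) =
  (P (rect m s U) * \prod_(k < d) P (D k @^-1` V k))%E.
Proof.
move=> hs mU mV.
have t0T : t0 <= T by rewrite (le_trans (ltW t01)).
pose s' j := if (j <= m)%N then s j else t1.
pose U' j k := if (j < m)%N then U j k else V k.
have hs' : subdivision m.+1 s' t1.
  case: hs => s0 sS sm; split; rewrite /s' ?leq0n// ?ltnn// => j.
  rewrite ltnS => jm; rewrite jm; case: (ltnP j m) => [|mj]; first exact: sS.
  by rewrite (_ : j = m) ?sm ?ltW//; apply/eqP; rewrite eqn_leq jm.
have mU' j k : measurable (U' j k) by rewrite /U'; case: ifP.
have incrE (j : nat) k : (j < m)%N -> incr s' j k = incr s j k.
  by move=> jm; rewrite /incr /s' jm ltnW.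
have incrD k : incr s' m k = D k.
  by case: hs => _ _ sm; rewrite /incr /s' ltnn leqnn sm.
have -> : rect m s U `&` \bigcap_(k in [set: 'I_d]) D k @^-1` V k =
    rect m.+1 s' U'.
  apply/seteqP; split=> [w [wU wV] [j k] _ /=|w wU].
    case: (ltnP j m) => jm.
      by rewrite incrE// /U' jm; exact: (wU (Ordinal jm, k) I).
    have -> : (j : nat) = m by apply/eqP; rewrite eqn_leq jm andbT -ltnS.
    by rewrite incrD /U' ltnn; exact: wV.
  split=> [[j k] _|k _] /=.
    have := wU (widen_ord (leqnSn m) j, k) I.
    by rewrite /= incrE// /U' ltn_ord.
  by have := wU (ord_max, k) I; rewrite /= incrD /U' ltnn.
rewrite (rect_prob hs')// (rect_prob hs)// big_ord_recr/=; congr (_ * _)%E.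
  apply: eq_bigr => j _; apply: eq_bigr => k _.
  by rewrite incrE// /U' ltn_ord.
by apply: eq_bigr => k _; rewrite incrD /U' ltnn.
Qed.

Hypothesis t00 : 0 <= t0.

Lemma measurable_D k : measurable_fun setT (D k).
Proof.
by apply: measurable_funB; apply: measurable_B;
  rewrite ?t00 ?(le_trans (ltW t01))// ?(le_trans t00)// ltW.
Qed.

Lemma D_moments k :
  [/\ P.-integrable setT (EFin \o (fun w => D k w ^+ 2)),
      \int[P]_w D k w = 0 & \int[P]_w (D k w ^+ 2) <= 8 * (t1 - t0)].
Proof.
have [_ _ _ law _] := hB.
have s0 : 0 < Num.sqrt (t1 - t0) by rewrite sqrtr_gt0 subr_gt0.
have := normal_rv s0 (measurable_D k) (law t0 t1 k t00 t01 t1T).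
by rewrite sqr_sqrtr// subr_ge0 ltW.
Qed.

Let iD k : P.-integrable setT (EFin \o D k).
Proof.
have [iD2 _ _] := D_moments k.
exact: integrable_sqr_integrable (measurable_D k) iD2.
Qed.

Let iDD k l : P.-integrable setT (EFin \o (fun w => D k w * D l w)).
Proof.
have [iDk _ _] := D_moments k; have [iDl _ _] := D_moments l.
by apply: integrable_mul => //; exact: measurable_D.
Qed.

Let mDV k V : measurable V -> measurable (D k @^-1` V).
Proof.
by move=> mV; rewrite -(setTI (_ @^-1` _)); exact: (measurable_D k).
Qed.

Lemma rect_indep_D m s U k V : subdivision m s t0 ->
  (forall j k, measurable (U j k)) -> measurable V ->
  P (rect m s U `&` D k @^-1` V) = (P (rect m s U) * P (D k @^-1` V))%E.
Proof.
(* The other components are left free and contribute factors 1. *)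
move=> hs mU mV; pose W k' := if k' == k then V else setT.
have mW k' : measurable (W k') by rewrite /W; case: ifP.
have := rect_next hs mU mW.
rewrite (_ : \bigcap_(k' in _) _ = D k @^-1` V); last first.
  apply/seteqP; split=> w => [/(_ k I)|Vw k' _]; rewrite /W /= ?eqxx//.
  by case: eqP => [->|].
have Wk : W k = V by rewrite /W eqxx.
rewrite (bigD1 k)//= Wk big1 ?mule1// => k' k'k.
by rewrite /W (negbTE k'k) preimage_setT probability_setT.
Qed.

(** The right-hand side keeps the box and D k together: this is the form in which
    [Rintegral_indep_event] is applied to D l on that joint event. *)
Lemma rect_indep_D2 m s U k l V V' : subdivision m s t0 ->
  (forall j k, measurable (U j k)) -> k != l -> measurable V -> measurable V' ->
  P (rect m s U `&` D k @^-1` V `&` D l @^-1` V') =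
  (P (rect m s U `&` D k @^-1` V) * P (D l @^-1` V'))%E.
Proof.
move=> hs mU kl mV mV'; rewrite (rect_indep_D k hs mU mV).
pose W k' := if k' == k then V else if k' == l then V' else setT.
have mW k' : measurable (W k') by rewrite /W; case: ifP => // _; case: ifP.
have := rect_next hs mU mW.
rewrite (_ : \bigcap_(k' in _) _ = D k @^-1` V `&` D l @^-1` V'); last first.
  apply/seteqP; split=> [w Ww|w [Vw V'w] k' _]; last first.
    by rewrite /W; case: eqP => [->//|_]; case: eqP => [->|].
  split; first by have := Ww k I; rewrite /W eqxx.
  by have := Ww l I; rewrite /W eq_sym (negbTE kl) eqxx.
rewrite setIA => ->.
rewrite (bigD1 k)//= (bigD1 l)/=; last by rewrite eq_sym.
have Wk : W k = V by rewrite /W eqxx.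
have Wl : W l = V' by rewrite /W eq_sym (negbTE kl) eqxx.
rewrite Wk Wl big1 ?mule1 ?muleA// => k' /andP[k'k k'l].
by rewrite /W (negbTE k'k) (negbTE k'l) preimage_setT probability_setT.
Qed.

Lemma rect_Rintegral_D m s U k : subdivision m s t0 ->
  (forall j k, measurable (U j k)) -> \int[P]_(w in rect m s U) D k w = 0.
Proof.
move=> hs mU; have [_ D0 _] := D_moments k.
rewrite Rintegral_indep_event ?D0 ?mulr0//.
  by apply: measurable_rect hs _ mU; rewrite (le_trans (ltW t01)).
by move=> V mV; exact: rect_indep_D.
Qed.

Let s2 k := \int[P]_w (D k w ^+ 2).

(** On the diagonal, D k ^+ 2 is a function of D k and hence independent of the box. Off the
    diagonal, the indicator of the box is attached to D l, and D k is the outer factor in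
    [Rintegral_mul_eq0]. *)
Lemma rect_Rintegral_DD m s U k l : subdivision m s t0 ->
  (forall j k, measurable (U j k)) ->
  \int[P]_(w in rect m s U) (D k w * D l w - (k == l)%:R * s2 k) = 0.
Proof.
move=> hs mU.
have mrect : measurable (rect m s U).
  by apply: measurable_rect hs _ mU; rewrite (le_trans (ltW t01)).
have icst : P.-integrable setT (EFin \o (fun=> (k == l)%:R * s2 k)).
  exact: finite_measure_integrable_cst.
rewrite RintegralB//; try exact: integrableS (subsetT _) _.
rewrite Rintegral_cst//.
have [<-|kl] := eqVneq k l.
  have [iD2 _ _] := D_moments k.
  rewrite (Rintegral_indep_event _ iD2)//.
    by rewrite mul1r mulrC subrr.
  move=> V mV.
  pose q (x : R) := x ^+ 2.
  have mq : measurable (q @^-1` V).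
    by rewrite -(setTI (_ @^-1` _)); apply: measurable_funX.
  exact: (rect_indep_D k hs mU mq).
rewrite mul0r mul0r subr0 -(Rintegral_indic_mul _ _ mrect).
under eq_Rintegral do rewrite mulrCA.
have m1 : measurable_fun setT (\1_(rect m s U) : Omega -> R).
  exact: measurable_indic.
have b1 w : `|\1_(rect m s U) w : R| <= 1.
  by rewrite indicE ger0_norm// lern1 leq_b1.
apply: Rintegral_mul_eq0.
- exact: measurable_D.
- exact: integrable_bounded_mul m1 b1 (iD l).
- move=> V mV; rewrite -(Rintegral_indic_mul _ _ (mDV k mV)).
  have [_ D0 _] := D_moments l.
  under eq_Rintegral do rewrite mulrA.
  rewrite (_ : (fun w => _) = fun w => \1_(rect m s U `&` D k @^-1` V) w * D l w); last first.
    by apply/funext => w; rewrite indicI /= [_ * \1_(rect _ _ _) w]mulrC.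
  have mRD : measurable (rect m s U `&` D k @^-1` V).
    by apply: measurableI => //; exact: mDV.
  rewrite (Rintegral_indic_mul _ _ mRD) Rintegral_indep_event ?D0 ?mulr0//.
  by move=> V' mV'; exact: rect_indep_D2.
- rewrite (_ : (fun w => _) = fun w => \1_(rect m s U) w * (D k w * D l w)).
    exact: integrable_bounded_mul m1 b1 (iDD k l).
  by apply/funext => w; rewrite mulrCA.
Qed.

End Next.

End BrownianIncrements.

(** * From boxes to the augmented filtration *)

Section BrownianFiltration.
Context (R : realType) (disp : measure_display) (Omega : measurableType disp)
  (P : probability Omega R) (d : nat) (T : R) (B : R -> Omega -> 'rV[R]_d).
Hypotheses (hB : is_brownian_motion P T B) (hP : measure_is_complete P).

Lemma sigma_brownian_filtration t :
  sigma_algebra setT (brownian_filtration P B t).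
Proof. exact: smallest_sigma_algebra. Qed.

(** Completeness of P makes the null sets added by the augmentation measurable. *)
Lemma brownian_filtration_measurable t : t <= T ->
  brownian_filtration P B t `<=` measurable.
Proof.
move=> tT; apply: smallest_sub; first exact: sigma_algebra_measurable.
move=> A [|]; last exact: hP.
move=> [s [k [U [st mU ->]]]]; rewrite -(setTI (_ @^-1` _)).
apply: (measurable_B (T := T) hB) => //.
by move: st; rewrite in_itv/= => /andP[-> /le_trans->].
Qed.

Lemma eq_Rintegral_negligible (A A' N : set Omega) (f : Omega -> R) :
  measurable A -> measurable A' -> P.-integrable setT (EFin \o f) ->
  P.-negligible N -> (forall w, ~ N w -> A w <-> A' w) ->
  \int[P]_(w in A) f w = \int[P]_(w in A') f w.
Proof.
move=> mA mA' fi nN AA'.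
have mf : measurable_fun setT (EFin \o f) by exact: (measurable_int P).
rewrite /Rintegral integral_mkcond [in RHS]integral_mkcond; congr fine.
apply: ae_eq_integral => //.
- exact/(measurable_restrictT _ mA)/measurable_funTS.
- exact/(measurable_restrictT _ mA')/measurable_funTS.
apply: negligibleS nN => w; apply: contra_notP => /AA' AA'w _.
rewrite /= !patchE; case: ifPn => [/set_mem/AA'w/mem_set->//|].
by case: ifPn => // /set_mem/AA'w/mem_set->.
Qed.

Section Rectangles.
Variables (t0 : R) (f : Omega -> R).
Hypotheses (t00 : 0 <= t0) (t0T : t0 <= T).
Hypothesis fi : P.-integrable setT (EFin \o f).
Hypothesis f_rect : forall m s U, subdivision m s t0 ->
  (forall j k, measurable (U j k)) -> \int[P]_(w in rect B m s U) f w = 0.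

Let rects m s : set (set Omega) :=
  [set A | exists U, (forall j k, measurable (U j k)) /\ A = rect B m s U].

Let f0 : \int[P]_w f w = 0.
Proof.
(* A grid without steps gives a box without constraints. *)
have := @f_rect 0 (fun=> t0) (fun _ _ => setT) _ _; rewrite [rect _ _ _ _](_ : _ = setT).
  by apply.
by apply/seteqP; split=> // w _ [[]].
Qed.

Let rects_zero m s A : subdivision m s t0 -> <<s rects m s >> A ->
  measurable A /\ \int[P]_(w in A) f w = 0.
Proof.
move=> hs; apply: zero_Rintegral_dynkin => //.
- by move=> _ [U [mU ->]]; exact: (measurable_rect hB hs t0T mU).
- move=> _ _ [U [mU ->]] [V [mV ->]]; exists (fun j k => U j k `&` V j k).
  split; first by move=> j k; exact: measurableI.
  by rewrite /rect -bigcapI; apply: eq_bigcapr => i _; rewrite preimage_setI.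
- by move=> _ [U [mU ->]]; exact: f_rect.
Qed.

Let measurable_incr_rects m s j k : (j < m)%N ->
  measurable_fun setT (incr B s j k : g_sigma_algebraType (rects m s) -> R).
Proof.
move=> jm _ U mU; rewrite setTI; apply: sub_sigma_algebra.
exists (fun j' k' => if (j' == j) && (k' == k) then U else setT); split.
  by move=> j' k'; case: ifP.
apply/seteqP; split=> [w Uw [j' k'] _ /=|w /(_ (Ordinal jm, k) I)].
  by case: ifPn => // /andP[/eqP -> /eqP ->].
by rewrite /= !eqxx.
Qed.

(** Increments determine B only up to its value at the first grid time; the difference
    telescopes. *)
Let measurable_B_rects m s j k : (j <= m)%N ->
  measurable_fun setT ((fun w => B (s j) w 0 k - B (s 0%N) w 0 k) :
    g_sigma_algebraType (rects m s) -> R).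
Proof.
move=> jm; rewrite (_ : (fun w => _) = fun w => \sum_(i < j) incr B s i k w).
  apply: measurable_sum => i.
  exact: (@measurable_incr_rects m s i k (leq_trans (ltn_ord i) jm)).
apply/funext => w; rewrite -(big_mkord xpredT (fun i => incr B s i k w)).
by rewrite (telescope_sumr (fun i => B (s i) w 0 k)).
Qed.

(** A pi-system generating the filtration: finite intersections of constraints on B at times up to
    [t0]. Null sets are members because the augmentation has them among its generators. *)
Inductive cylinder : set Omega -> Prop :=
| cylinder_negligible A : P.-negligible A -> cylinder A
| cylinder_setT : cylinder setT
| cylinder_cons s k U A : s \in `[0, t0] -> measurable U -> cylinder A ->
    cylinder ((fun w => B s w 0 k) @^-1` U `&` A).

Let cylinderI : setI_closed cylinder.
Proof.
move=> A A' cA cA'; elim: cA => {A}[A nA| |s k U A st mU cA IH].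
- by apply: cylinder_negligible; apply: negligibleS nA => w [].
- by rewrite setTI.
- by rewrite -setIA; exact: cylinder_cons.
Qed.

(* Up to a negligible set, a cylinder is generated by the increments along any
   subdivision that contains its finitely many times. *)
Let cylinder_rects A : cylinder A ->
  exists2 r : seq R, {subset r <= `[0, t0]} &
    forall m s, s 0%N = 0 -> (forall x, x \in r -> exists2 j, (j <= m)%N & s j = x) ->
      exists A' N, [/\ <<s rects m s >> A', P.-negligible N &
        forall w, ~ N w -> A w <-> A' w].
Proof.
have [_ B0 _ _ _] := hB.
elim=> {A}[A nA| |u k U A ut mU _ [r rt IH]].
- exists [::] => // m s _ _; exists set0, A; split=> //.
  exact: sigma_algebra0.
- exists [::] => // m s _ _; exists setT, set0; split=> //.
    exact: (@measurableT _ (g_sigma_algebraType (rects m s))).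
  exact: negligible_set0.
exists (u :: r).
  by move=> x; rewrite inE => /orP[/eqP->|/rt].
move=> m s s0 sr.
have [A' [N [sA' nN AA']]] := IH m s s0 (fun x xr => sr x (mem_behead (s := u :: r) xr)).
have [j jm sju] := sr u (mem_head _ _).
exists ((fun w => B (s j) w 0 k - B (s 0%N) w 0 k) @^-1` U `&` A').
(* B starts at 0 only almost surely, so {B 0 <> 0} joins the exceptional set; outside it B (s j) - B
   (s 0) is B (s j). *)
exists (N `|` ~` [set w | B 0 w = 0]); split.
- apply: (@measurableI _ (g_sigma_algebraType (rects m s))) => //.
  by rewrite -(setTI (_ @^-1` _)); exact: (measurable_B_rects k jm).
- exact: negligibleU.
- move=> w /not_orP[/AA' AA'w /contrapT/= B0w].
  rewrite /= sju s0 B0w mxE subr0.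
  by split=> -[? ?]; split=> //; exact/AA'w.
Qed.

Let subdivision_seq (r : seq R) : {subset r <= `[0, t0]} ->
  exists m s, [/\ subdivision m s t0, s 0%N = 0 &
    forall x, x \in r -> exists2 j, (j <= m)%N & s j = x].
Proof.
move=> rt; pose l := sort <=%R r.
have lt j : 0 <= nth t0 l j <= t0.
  have [jl|jl] := ltnP j (size l); last by rewrite nth_default// t00 lexx.
  by have := rt (nth t0 l j); rewrite -(mem_sort <=%R) mem_nth// in_itv; exact.
(* Time 0 is put before the sorted times; the default value of [nth] supplies the last grid point
   [t0], at index [(size l).+1]. *)
exists (size l).+1, (fun j => if j is i.+1 then nth t0 l i else 0); split=> //.
  split=> //; last by rewrite nth_default.
  move=> [_|j jl]; first by case/andP: (lt 0%N).
  have [jl'|jl'] := ltnP j.+1 (size l); last first.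
    by rewrite [leRHS]nth_default//; case/andP: (lt j).
  have sl : sorted <=%R l by exact: sort_le_sorted.
  by apply: (sorted_leq_nth le_trans (@lexx _ _) t0 sl); rewrite ?inE// ltnW.
move=> x; rewrite -(mem_sort <=%R) => xl; exists (index x l).+1.
  by rewrite ltnS index_size.
by rewrite nth_index.
Qed.

(** The grid depends on the cylinder, hence two pi-lambda arguments: one from boxes to the
    sigma-algebra of a fixed grid, which contains each cylinder with times on that grid up to a null
    set, and one from cylinders to the filtration. *)
Lemma cond_centered_brownian :
  cond_centered P (brownian_filtration P B t0) f.
Proof.
split=> // A FA.
have mcyl : cylinder `<=` measurable.
  move=> A0; elim=> [A' nA'| |s k U A' st mU _ mA']; [exact: hP|exact: measurableT|].
  apply: measurableI => //; rewrite -(setTI (_ @^-1` _)).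
  apply: (measurable_B (T := T) hB) => //.
  by move: st; rewrite in_itv/= => /andP[-> /le_trans->].
suff : <<s cylinder >> A.
  move=> /(zero_Rintegral_dynkin mcyl cylinderI fi f0); case=> // A' cA'.
  have [r rt rA'] := cylinder_rects cA'.
  have [m [s [hs s0 sr]]] := subdivision_seq rt.
  have [A'' [N [sA'' nN AA'']]] := rA' m s s0 sr.
  have [mA'' fA''] := rects_zero hs sA''.
  by rewrite (eq_Rintegral_negligible _ mA'' fi nN AA'')//; exact: mcyl.
apply: sub_sigma_algebra2 FA => A' [[s [k [U [st mU ->]]]]|nA'].
  rewrite -[_ @^-1` _]setIT; apply: cylinder_cons => //.
  exact: cylinder_setT.
exact: cylinder_negligible.
Qed.

End Rectangles.

Section NextIncrement.
Variables (t0 t1 : R).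
Hypotheses (t00 : 0 <= t0) (t01 : t0 < t1) (t1T : t1 <= T).
Let D k w := B t1 w 0 k - B t0 w 0 k.

Let t0T : t0 <= T. Proof. by rewrite (le_trans (ltW t01)). Qed.

Lemma cond_centered_increment k :
  cond_centered P (brownian_filtration P B t0) (D k).
Proof.
have [iD2 _ _] := D_moments hB t01 t1T t00 k.
apply: cond_centered_brownian => //.
  by apply: integrable_sqr_integrable iD2; exact: (measurable_D hB t01 t1T t00).
by move=> m s U hs mU; exact: (rect_Rintegral_D hB t01 t1T t00 k hs mU).
Qed.

Lemma cond_centered_increment2 k l :
  cond_centered P (brownian_filtration P B t0)
    (fun w => D k w * D l w - (k == l)%:R * \int[P]_w (D k w ^+ 2)).
Proof.
have [iDk _ _] := D_moments hB t01 t1T t00 k.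
have [iDl _ _] := D_moments hB t01 t1T t00 l.
apply: cond_centered_brownian => //.
  have mD := measurable_D hB t01 t1T t00.
  have iDD := integrable_mul (mD k) (mD l) iDk iDl.
  pose c := (k == l)%:R * \int[P]_w (D k w ^+ 2).
  have ic : P.-integrable setT (EFin \o (cst c : Omega -> R)).
    exact: finite_measure_integrable_cst.
  exact: (integrableB measurableT iDD ic).
by move=> m s U hs mU; exact: (rect_Rintegral_DD hB t01 t1T t00 k l hs mU).
Qed.

End NextIncrement.

End BrownianFiltration.

(** * Measurability of Hermite polynomials and of the chaos projection *)

Section Hermite.
Context (R : realType).

Let gauss (y : R) := expR (- (y ^+ 2 / 2)).

Let is_derive_gauss (x : R) : is_derive x 1 gauss (- x * gauss x).
Proof.
rewrite /gauss.
apply: is_derive_eq.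
by rewrite /GRing.scale/=; field.
Qed.

(** Serves the measurability of [hermite]: differentiation keeps the shape polynomial times
    Gaussian, with p replaced by p' - X p. *)
Lemma derive1n_gauss n :
  exists p : {poly R}, derive1n n gauss = fun x => p.[x] * gauss x.
Proof.
elim: n => [|n [p IH]].
  by exists 1; apply/funext => x; rewrite /= hornerE mul1r.
exists (p^`() - 'X * p)%R; rewrite derive1nS IH; apply/funext => x.
rewrite derive1E.
have dp : is_derive x 1 (horner p) (p^`().[x]).
  apply: DeriveDef; first exact: derivable_horner.
  by rewrite -derive1E -derivE.
have dg := is_derive_gauss x.
have -> : (fun x => p.[x] * gauss x) = horner p * gauss by [].
rewrite derive_val /GRing.scale/= hornerD hornerN hornerM hornerX.
by ring.
Qed.

Lemma measurable_hermite n : measurable_fun setT (@hermite R n).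
Proof.
rewrite /hermite -/gauss; have [p ->] := derive1n_gauss n.
apply: measurable_funM.
  apply: measurable_funM => //; apply: measurableT_comp => //.
  by apply: measurable_funM => //; exact: measurable_funX.
apply: measurable_funM.
  by apply: continuous_measurable_fun; exact: continuous_horner.
apply: measurableT_comp => //; apply: measurableT_comp => //.
by apply: measurable_funM => //; exact: measurable_funX.
Qed.

End Hermite.

Section Chaos.
Context (R : realType) (disp : measure_display) (Omega : measurableType disp)
  (P : probability Omega R) (d : nat) (T : R) (B : R -> Omega -> 'rV[R]_d).
Hypotheses (hB : is_brownian_motion P T B) (hP : measure_is_complete P).
Implicit Types (X Y : Omega -> R) (N : set Omega).
Local Notation F := (brownian_filtration P B T).

Let sF : sigma_algebra setT F := sigma_brownian_filtration P B T.

Lemma brownian_filtration_negligible N : P.-negligible N -> F N.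
Proof. by move=> nN; apply: sub_sigma_algebra; right. Qed.

Lemma measurable_wrt_ae X Y N : P.-negligible N ->
  (forall w, ~ N w -> X w = Y w) -> measurable_wrt F X -> measurable_wrt F Y.
Proof.
move=> nN XY mX U mU; pose O' := g_sigma_algebraType F.
have -> : Y @^-1` U = (X @^-1` U `\` N) `|` (Y @^-1` U `&` N).
  apply/seteqP; split=> w /=.
    by move=> YU; case: (pselect (N w)) => Nw; [right|left; split=> //; rewrite XY].
  by case=> [[XU Nw]|[]//]; rewrite -XY.
rewrite -(sigma_algebra_id sF); apply: (@measurableU _ O').
  by apply: (@measurableD _ O'); apply: sub_sigma_algebra;
    [exact: mX|exact: brownian_filtration_negligible].
apply: sub_sigma_algebra; apply: brownian_filtration_negligible.
by apply: negligibleS nN => w [].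
Qed.

Lemma measurable_wrt_B t k : t \in `[0, T] ->
  measurable_wrt F (fun w => B t w 0 k).
Proof.
move=> tT U mU; apply: sub_sigma_algebra; left.
by exists t, k, U.
Qed.

Lemma measurable_wrt_step_integral m (s : nat -> R) (c : nat -> 'rV[R]_d) :
  0 <= s 0%N -> (forall j, (j < m)%N -> s j <= s j.+1) -> s m <= T ->
  measurable_wrt F (step_integral B m s c).
Proof.
move=> s0 sS sT; have hs : subdivision m s (s m) by [].
have st j : (j <= m)%N -> s j \in `[0, T].
  move=> /(subdivision_le hs)/andP[? /le_trans sj].
  by rewrite in_itv/=; apply/andP; split; last exact: sj.
apply/(measurable_wrtP sF); apply: measurable_sum => j.
rewrite /dot; apply: measurable_sum => k; apply: measurable_funM => //.
under eq_fun do rewrite !mxE.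
apply: measurable_funB; apply/(measurable_wrtP sF); apply: measurable_wrt_B;
  apply: st => //; exact: ltnW.
Qed.

(** The expected squared errors are summable, so their sum is finite a.e. and its terms tend to 0;
    with this rate no subsequence has to be extracted. *)
Lemma ae_cvg_L2 X (S : nat -> Omega -> R) :
  measurable_fun setT X -> (forall n, measurable_fun setT (S n)) ->
  (forall n, (\int[P]_w ((X w - S n w) ^+ 2)%:E <= (1 / (2 ^ n.+1)%:R)%:E)%E) ->
  {ae P, forall w, S n w @[n --> \oo] --> X w}.
Proof.
move=> mX mS XS; pose f n w := ((X w - S n w) ^+ 2)%:E.
have mf n : measurable_fun setT (f n).
  by apply/measurable_EFinP/measurable_funX; exact: measurable_funB.
have f0 n w : (0 <= f n w)%E by rewrite lee_fin sqr_ge0.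
have mSf : measurable_fun setT (fun w => \sum_(n <oo) f n w)%E.
  by apply: ge0_emeasurable_sum => // n w _ _; exact: f0.
have iSf : P.-integrable setT (fun w => \sum_(n <oo) f n w)%E.
  apply/integrableP; split=> //.
  under eq_integral do rewrite gee0_abs ?nneseries_ge0//.
  rewrite integral_nneseries//.
  apply: (@le_lt_trans _ _ 1%E); last by rewrite ltry.
  apply: le_trans (epsilon_trick0 xpredT ler01).
  apply: lee_nneseries => n *; last exact: XS.
  by apply: integral_ge0 => w _; exact: f0.
apply: filterS (integrable_ae measurableT iSf) => w /(_ I) fin.
pose u n := (X w - S n w) ^+ 2.
have u0 : u n @[n --> \oo] --> 0.
  apply: cvg_series_cvg_0; apply: nondecreasing_is_cvgn.
    apply/nondecreasing_seqP => n.
    by rewrite /series/= big_nat_recr//= lerDl sqr_ge0.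
  exists (fine (\sum_(n <oo) f n w)) => _ [n _ <-].
  rewrite -lee_fin fineK// /series/= -sumEFin.
  by apply: (@nneseries_lim_ge _ (f^~ w) xpredT 0%N n) => *.
have : Num.sqrt (u n) @[n --> \oo] --> Num.sqrt (0 : R).
  exact: (cvg_comp _ _ u0 (@sqrt_continuous R 0)).
rewrite sqrtr0; under eq_cvg do rewrite sqrtr_sqr.
move=> /norm_cvg0P XS0.
have : X w - (X w - S n w) @[n --> \oo] --> X w - 0.
  by apply: cvgB => //; exact: cvg_cst.
by rewrite subr0; under eq_cvg do rewrite subKr.
Qed.

(** [is_wiener_integral] only says that X is measurable on [Omega]; measurability for F_T comes from
    an a.e. limit of step integrals, since F_T contains the null sets. *)
Lemma measurable_wrt_wiener (h : R -> 'rV[R]_d) X :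
  is_wiener_integral P B T h X -> measurable_wrt F X.
Proof.
move=> [mX appr].
have /choice[S HS] n : exists S, measurable_wrt F S /\
    (\int[P]_w ((X w - S w) ^+ 2)%:E <= (1 / (2 ^ n.+1)%:R)%:E)%E.
  have e0 : 0 < 1 / (2 ^ n.+1)%:R :> R by rewrite divr_gt0// ltr0n expn_gt0.
  have [m [s [c [s0 sS sT _ XS]]]] := appr _ e0.
  exists (step_integral B m s c); split; first exact: measurable_wrt_step_integral.
  by move: XS; rewrite unlock.
have mF := brownian_filtration_measurable hB hP (lexx T).
have [N [mN N0 XN]] : {ae P, forall w, S n w @[n --> \oo] --> X w}.
  apply: ae_cvg_L2 => // n; last by have [] := HS n.
  by have [/(measurable_wrt_fun mF)] := HS n.
have nN : P.-negligible N by exists N; split.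
(* Killing everything on the null set N, an element of F_T, turns a.e. convergence into convergence
   everywhere. *)
pose X' w := \1_(~` N) w * X w.
have cvgX' w : \1_(~` N) w * S n w @[n --> \oo] --> X' w.
  rewrite /X' indicE; case: (boolP (w \in ~` N)) => [/set_mem Nw|_].
    rewrite mul1r; under eq_cvg do rewrite mul1r.
    by apply: contrapT => ncvg; apply: Nw; exact: XN.
  by rewrite mul0r; under eq_cvg do rewrite mul0r; exact: cvg_cst.
apply: (measurable_wrt_ae nN (X := X')).
  by move=> w Nw; rewrite /X' indicE mem_set// mul1r.
apply/(measurable_wrtP sF).
apply: (@measurable_fun_cvg _ (g_sigma_algebraType F) R setT
  (fun n w => \1_(~` N) w * S n w) X'); last by move=> w _; exact: cvgX'.
move=> n; apply: measurable_funM; last by apply/(measurable_wrtP sF); have [] := HS n.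
apply: measurable_indic; apply: measurableC; apply: sub_sigma_algebra.
exact: brownian_filtration_negligible.
Qed.

(** Allows the sum over a set in [chaos_proj] to be read as an ordinary finite sum. Each entry is at
    most the length, hence at most p, and the first M entries determine the sequence. *)
Lemma finite_mindex (p M : nat) :
  finite_set [set a : mindex | (mlength a <= p)%N /\
                               forall k, (M <= k)%N -> a k = 0%N].
Proof.
pose D := [fset k in iota 0 M]%fset.
pose f (u : {ffun 'I_M -> 'I_p.+1}) : mindex :=
  [fsfun k in D => (if insub k is Some i then u i : nat else 0%N) | 0%N].
apply: (@sub_finite_set _ _ (range f)); last first.
  by apply: finite_image; exact: finite_finset.
move=> a [ap aM]; exists [ffun i : 'I_M => inord (a i)] => //=.
apply/fsfunP => k; rewrite fsfunE inE mem_iota add0n /=.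
case: ltnP => [kM|/aM->//].
rewrite insubT ffunE/= inordK// ltnS; apply: leq_trans ap.
have [ka|] := boolP (k \in finsupp a); last by rewrite memNfinsupp => /eqP->.
by rewrite /mlength (big_fsetD1 k ka)/= leq_addr.
Qed.

Lemma measurable_wrt_chaos_proj (W : nat -> R -> Omega -> R) p M xi :
  (forall i, measurable_wrt F (W i T)) ->
  measurable_wrt F (chaos_proj T P W p M xi).
Proof.
move=> mW; apply/(measurable_wrtP sF); rewrite /chaos_proj.
under eq_fun do rewrite (fsbig_finite _ _ (finite_mindex p M)).
apply: measurable_sum => a; apply: measurable_funM => //.
apply: measurable_prod => i _; apply: measurableT_comp.
  exact: measurable_hermite.
exact/(measurable_wrtP sF).
Qed.

End Chaos.

(** * Real inequalities: one backward step and discrete Gronwall *)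

Section StepConstant.
Context (R : realType).

(** The rate c: the first summand absorbs the Young weight 1 + 16 L^2 D, the second absorbs (1 - L
    D)^-2. *)
Definition growth (L rho : R) : R := 16 * L ^+ 2 + 2 * L / (1 - L * rho).

Lemma growth_ge0 (L rho : R) : 0 < L -> L * rho < 1 -> 0 <= growth L rho.
Proof.
move=> L0 Lr; rewrite addr_ge0//; first by rewrite mulr_ge0// sqr_ge0.
by rewrite divr_ge0//; [rewrite mulr_ge0// ltW|lra].
Qed.

(** Half of the Bessel term D / 8 * z^2 pays for the z-part of the Lipschitz bound; the other half
    survives on the left. *)
Lemma step_inequality (L rho D y m z : R) :
  0 < L -> L * rho < 1 -> 0 < D -> D <= rho -> 0 <= z ->
  `|y - m| <= D * (L * (`|y| + z)) ->
  expR (- (growth L rho * D)) * y ^+ 2 + D / 16 * z ^+ 2 <=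
  m ^+ 2 + D / 8 * z ^+ 2.
Proof.
move=> L0 Lr D0 Dr z0 ym.
set k := 1 - L * rho; have k0 : 0 < k by rewrite subr_gt0.
have LD : k <= 1 - L * D by rewrite lerB// ler_pM2l.
have LD0 : 0 < 1 - L * D by exact: lt_le_trans LD.
pose th := 1 + 16 * L ^+ 2 * D.
have th0 : 0 < th.
  by rewrite /th ltr_pwDl// mulr_ge0 ?(ltW D0)// mulr_ge0// sqr_ge0.
(* Cauchy-Schwarz for the vectors (1, 4 L sqrt D) and (|m|, sqrt D z / 4), after moving L D |y| to
   the left. *)
have young : (1 - L * D) ^+ 2 * y ^+ 2 <= th * (m ^+ 2 + D / 16 * z ^+ 2).
  have le1 : (1 - L * D) * `|y| <= `|m| + L * D * z.
    have := lerB_dist y m; nra.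
  have := ler_pM (mulr_ge0 (ltW LD0) (normr_ge0 y)) (mulr_ge0 (ltW LD0) (normr_ge0 y)) le1 le1.
  rewrite (_ : _ * _ = (1 - L * D) ^+ 2 * y ^+ 2); last first.
    by rewrite -[in RHS](real_normK (num_real y)); ring.
  move=> /le_trans; apply.
  rewrite -subr_ge0 -(real_normK (num_real m)).
  have -> : th * (`|m| ^+ 2 + D / 16 * z ^+ 2) -
      (`|m| + L * D * z) * (`|m| + L * D * z) =
      D * (4 * L * `|m| - z / 4) ^+ 2 by rewrite /th; field.
  by rewrite mulr_ge0 ?sqr_ge0// ltW.
have expb : expR (- (growth L rho * D)) * th <= (1 - L * D) ^+ 2.
  have e1 : th <= expR (16 * L ^+ 2 * D) by exact: expR_ge1Dx.
  (* Indeed (1 - L D)^-1 <= 1 + (L / k) D, because 1 - L D >= k. *)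
  have e2 : (1 - L * D)^-1 <= expR (L / k * D).
    apply: le_trans (expR_ge1Dx _).
    rewrite -div1r ler_pdivrMr//.
    have kk : L / k * D * (1 - L * D) >= L * D.
      have -> : L / k * D * (1 - L * D) = L * D * ((1 - L * D) / k).
        by field; rewrite gt_eqF.
      rewrite ler_peMr ?ler_pdivlMr ?mul1r//.
      by rewrite mulr_ge0 ?ltW.
    by move: kk; rewrite mulrDl; lra.
  have e2' : 1 <= expR (L / k * D) * (1 - L * D) by rewrite -ler_pdivrMr// div1r.
  have eE : expR (- (growth L rho * D)) =
      expR (- (16 * L ^+ 2 * D)) * (expR (- (L / k * D)) * expR (- (L / k * D))).
    by rewrite -!expRD; congr expR; rewrite /growth -/k; field; rewrite gt_eqF.
  have f1 : expR (- (16 * L ^+ 2 * D)) * th <= 1.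
    by rewrite expRN mulrC ler_pdivrMr ?expR_gt0// mul1r.
  have f2 : expR (- (L / k * D)) <= 1 - L * D.
    by rewrite expRN -[leLHS]mul1r ler_pdivrMr ?expR_gt0// mulrC.
  have g1 : 0 <= expR (- (16 * L ^+ 2 * D)) * th.
    by rewrite mulr_ge0 ?expR_ge0// ltW.
  have g2 := expR_ge0 (- (L / k * D)).
  rewrite eE mulrAC -[leRHS]mul1r [(1 - L * D) ^+ 2]expr2.
  exact: (ler_pM g1 (mulr_ge0 g2 g2) f1 (ler_pM g2 g2 f2 f2)).
have ey : expR (- (growth L rho * D)) * y ^+ 2 <= m ^+ 2 + D / 16 * z ^+ 2.
  rewrite -(ler_pM2l th0) mulrA [th * _]mulrC; apply: le_trans young.
  by rewrite ler_wpM2r// sqr_ge0.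
by move: ey; lra.
Qed.

(** The bound on e iterates the step without its z-term. For the sum, e^(-cD) is lowered to 1 - c D:
    the differences of e telescope, and the remaining c D e_i is controlled by the first bound. *)
Lemma backward_gronwall (c : R) (n : nat) (t e z : nat -> R) :
  0 <= c -> t 0%N = 0 -> (forall i, (i < n)%N -> t i <= t i.+1) ->
  (forall i, (i <= n)%N -> 0 <= e i) -> (forall i, (i < n)%N -> 0 <= z i) ->
  (forall i, (i < n)%N ->
     expR (- (c * (t i.+1 - t i))) * e i + (t i.+1 - t i) / 16 * z i
     <= e i.+1) ->
  (forall i, (i <= n)%N -> e i <= expR (c * t n) * e n) /\
  \sum_(i < n) (t i.+1 - t i) * z i <=
    16 * (1 + c * t n * expR (c * t n)) * e n.
Proof.
move=> c0 t0 tS e0 z0 step.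
(* [j] counts the steps back from the terminal index. *)
have bound j : (j <= n)%N -> e (n - j)%N <= expR (c * (t n - t (n - j)%N)) * e n.
  elim: j => [|j IH] jn; first by rewrite subn0 subrr mulr0 expR0 mul1r.
  have nj : (n - j.+1 < n)%N by rewrite ltn_subrL (leq_trans _ jn).
  have nS : (n - j.+1).+1 = (n - j)%N by rewrite subnSK.
  have := step _ nj; rewrite nS; have := IH (ltnW jn).
  set D := t (n - j)%N - t (n - j.+1)%N => IHj stepj.
  have D0 : 0 <= D by rewrite subr_ge0 -nS tS.
  have : expR (- (c * D)) * e (n - j.+1)%N <= e (n - j)%N.
    apply: le_trans stepj; rewrite lerDl mulr_ge0 ?z0//.
    by rewrite divr_ge0.
  rewrite expRN ler_pdivrMl ?expR_gt0// => /le_trans; apply.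
  rewrite (_ : t n - t (n - j.+1)%N = D + (t n - t (n - j)%N)); last first.
    by rewrite /D; ring.
  rewrite [c * (D + _)]mulrDr expRD -mulrA.
  by rewrite ler_wpM2l ?expR_ge0.
have t_ge0 i : (i <= n)%N -> 0 <= t i.
  elim: i => [|i IH] ilt; first by rewrite t0.
  by rewrite (le_trans (IH (ltnW ilt))) ?tS.
have ebound i : (i <= n)%N -> e i <= expR (c * t n) * e n.
  move=> ilen; have := bound (n - i)%N (leq_subr _ _); rewrite subKn//.
  move=> /le_trans; apply; rewrite ler_wpM2r ?e0// ler_expR ler_wpM2l//.
  by rewrite gerBl t_ge0.
split=> //; set K := expR (c * t n).
have term i : (i < n)%N ->
    (t i.+1 - t i) * z i <= 16 * (e i.+1 - e i + (t i.+1 - t i) * (c * (K * e n))).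
  move=> ilt; have := step i ilt.
  set D := t i.+1 - t i => stepi.
  have D0 : 0 <= D by rewrite subr_ge0 tS.
  have eD : (1 - c * D) * e i <= expR (- (c * D)) * e i.
    by rewrite ler_wpM2r ?e0 ?(ltnW ilt)// expR_ge1Dx.
  have cDe : c * D * e i <= D * (c * (K * e n)).
    rewrite [c * D]mulrC -mulrA ler_wpM2l// ler_wpM2l//.
    exact: ebound (ltnW ilt).
  move: stepi eD cDe; rewrite (mulrBl (e i) 1 (c * D)) mul1r [D / 16 * _]mulrAC; lra.
have sumle : \sum_(i < n) (t i.+1 - t i) * z i <=
    \sum_(i < n) 16 * (e i.+1 - e i + (t i.+1 - t i) * (c * (K * e n))).
  by apply: ler_sum => i _; exact: term.
apply: le_trans sumle _.
rewrite -mulr_sumr big_split/= -mulr_suml.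
rewrite -(big_mkord xpredT (fun i => e i.+1 - e i)) telescope_sumr//.
rewrite -(big_mkord xpredT (fun i => t i.+1 - t i)) telescope_sumr//.
rewrite t0 subr0 -mulrA ler_wpM2l// mulrDl mul1r lerD//.
  by rewrite gerBl e0.
by rewrite le_eqVlt; apply/orP; left; apply/eqP; ring.
Qed.

End StepConstant.

(** * Almost everywhere equality under a complete measure *)

Section CompleteMeasure.
Context (R : realType) (disp : measure_display) (Omega : measurableType disp)
  (P : probability Omega R).
Hypothesis hP : measure_is_complete P.

(** The values of [Z], [sY] and [sZ] along paths are accessed only through a.e. equality with
    measurable functions; completeness then makes the expressions built from them measurable. *)
Lemma ae_eq_integral_complete (f g : Omega -> \bar R) :
  measurable_fun setT g -> {ae P, forall w, f w = g w} ->
  measurable_fun setT f /\ (\int[P]_w f w = \int[P]_w g w)%E.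
Proof.
move=> mg fg; have mf : measurable_fun setT f.
  by apply: (ae_measurable_fun hP _ mg); apply: filterS fg => w -> _.
by split=> //; apply: ae_eq_integral => //; apply: filterS fg => w -> _.
Qed.

Lemma ae_eq_integrable (f g : Omega -> R) :
  P.-integrable setT (EFin \o g) -> {ae P, forall w, f w = g w} ->
  P.-integrable setT (EFin \o f) /\ \int[P]_w f w = \int[P]_w g w.
Proof.
move=> ig fg; have mg := measurable_int P ig.
have fgE : {ae P, forall w, (EFin \o f) w = (EFin \o g) w}.
  by apply: filterS fg => w /= ->.
have [mf fgi] := ae_eq_integral_complete mg fgE.
split; last by rewrite /Rintegral; congr fine.
apply/integrableP; split=> //; have /integrableP[_] := ig.
apply: le_lt_trans; rewrite le_eqVlt; apply/orP; left; apply/eqP.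
apply: ae_eq_integral => //; try exact: measurableT_comp.
by apply: filterS fg => w /= -> _.
Qed.

End CompleteMeasure.

(** * One step for the difference of two solutions *)

Section SchemeStability.
Context (R : realType) (disp : measure_display) (Omega : measurableType disp)
  (P : probability Omega R).
Implicit Types (X Y : Omega -> R) (G : set (set Omega)).

Lemma L2_integrable_sqr G X : G `<=` measurable -> L2 P G X ->
  P.-integrable setT (EFin \o (fun w => X w ^+ 2)).
Proof.
move=> mG [mX]; rewrite unlock => X2.
have mX' := measurable_wrt_fun mG mX.
apply/integrableP; split; first by apply/measurable_EFinP/measurable_funX.
by under eq_integral do rewrite /= ger0_norm ?sqr_ge0//.
Qed.

Lemma integrable_sqrB X Y :
  measurable_fun setT X -> measurable_fun setT Y ->
  P.-integrable setT (EFin \o (fun w => X w ^+ 2)) ->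
  P.-integrable setT (EFin \o (fun w => Y w ^+ 2)) ->
  P.-integrable setT (EFin \o (fun w => (X w - Y w) ^+ 2)).
Proof.
move=> mX mY iX iY.
have i2 := integrableZl measurableT 2 (integrableD measurableT iX iY).
apply: (le_integrable _ _ _ i2) => //.
  by apply/measurable_EFinP/measurable_funX; exact: measurable_funB.
move=> w _; rewrite /= lee_fin !ger0_norm ?sqr_ge0//.
  by rewrite -subr_ge0; have := sqr_ge0 (X w + Y w); nra.
by rewrite mulr_ge0// addr_ge0// sqr_ge0.
Qed.

Lemma enorm_sqr (d : nat) (x : 'rV[R]_d) : enorm x ^+ 2 = \sum_k x 0 k ^+ 2.
Proof.
rewrite /enorm /dot sqr_sqrtr; first by apply: eq_bigr => k _; rewrite expr2.
by rewrite sumr_ge0// => k _; rewrite -expr2 sqr_ge0.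
Qed.

Context (d : nat) (T : R) (B : R -> Omega -> 'rV[R]_d).
Hypotheses (hB : is_brownian_motion P T B) (hP : measure_is_complete P).
Variables (g : R -> R -> 'rV[R]_d -> R) (L rho : R).
Hypotheses (L0 : 0 < L) (Lr : L * rho < 1).
Variables (n : nat) (t : nat -> R).
Hypothesis ht : is_partition T n t.
Variables (xi xi' : Omega -> R) (Y Y' : nat -> Omega -> R)
  (Z Z' : nat -> Omega -> 'rV[R]_d).
Hypotheses (hY : is_scheme P B g n t xi Y Z)
  (hY' : is_scheme P B g n t xi' Y' Z').
Local Notation F := (brownian_filtration P B).

Lemma partition_bounds i : (i <= n)%N -> 0 <= t i <= T.
Proof.
case: ht => t0 tn tS; apply: (@subdivision_le R n t T); split=> //.
  by rewrite t0.
by move=> j /tS/ltW.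
Qed.

Let mF i : (i <= n)%N -> F (t i) `<=` measurable.
Proof.
by move=> /partition_bounds/andP[_ tT]; exact: (brownian_filtration_measurable hB hP tT).
Qed.

Lemma scheme_diff_integrable i : (i <= n)%N ->
  P.-integrable setT (EFin \o (fun w => (Y i w - Y' i w) ^+ 2)).
Proof.
move=> ilen; case: hY hY' => _ _ + _ _ [_ _ + _ _].
move=> /(_ i ilen) LY /(_ i ilen) LY'; have mG := mF ilen.
apply: integrable_sqrB.
- by case: LY => mY _; exact: (measurable_wrt_fun mG mY).
- by case: LY' => mY _; exact: (measurable_wrt_fun mG mY).
- exact: (L2_integrable_sqr mG LY).
- exact: (L2_integrable_sqr mG LY').
Qed.

Lemma scheme_step i : (i < n)%N -> t i.+1 - t i <= rho ->
  lipschitz_at g L (t i) ->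
  P.-integrable setT (EFin \o (fun w => enorm (Z i w - Z' i w) ^+ 2)) /\
  expR (- (growth L rho * (t i.+1 - t i))) * \int[P]_w ((Y i w - Y' i w) ^+ 2)
  + (t i.+1 - t i) / 16 * \int[P]_w (enorm (Z i w - Z' i w) ^+ 2)
  <= \int[P]_w ((Y i.+1 w - Y' i.+1 w) ^+ 2).
Proof.
move=> ilt; set D := t i.+1 - t i => Dr glip.
have [_ _ tS] := ht; have tt := tS i ilt.
have D0 : 0 < D by rewrite subr_gt0.
have /andP[ti0 _] := partition_bounds (ltnW ilt).
have /andP[_ tiT] := partition_bounds ilt.
have sG := sigma_brownian_filtration P B (t i).
have mG := mF (ltnW ilt).
have [_ _ _ /(_ i ilt)[V [cV ZV]] /(_ i ilt)[U [cU YU]]] := hY.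
have [_ _ _ /(_ i ilt)[V' [cV' ZV']] /(_ i ilt)[U' [cU' YU']]] := hY'.
have iy := scheme_diff_integrable ilt.
have iYi := scheme_diff_integrable (ltnW ilt).
pose y w := Y i.+1 w - Y' i.+1 w.
pose m w := U w - U' w.
pose v k w := V w 0 k - V' w 0 k.
pose DB k w := B (t i.+1) w 0 k - B (t i) w 0 k.
have wrtB X1 X2 : measurable_wrt (F (t i)) X1 -> measurable_wrt (F (t i)) X2 ->
    measurable_wrt (F (t i)) (fun w => X1 w - X2 w).
  move=> m1 m2; apply/(measurable_wrtP sG).
  by apply: measurable_funB; exact/(measurable_wrtP sG).
have mm : measurable_wrt (F (t i)) m.
  by apply: wrtB; [case: cU|case: cU'].
have mv k : measurable_wrt (F (t i)) (v k).
  by apply: wrtB; [case: (cV k)|case: (cV' k)].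
have cm : cond_centered P (F (t i)) (fun w => y w - m w).
  have := cond_centeredB mG (cond_exp_centered mG cU) (cond_exp_centered mG cU').
  congr cond_centered; apply/funext => w; rewrite /y /m; ring.
have cv k : cond_centered P (F (t i)) (fun w => y w * DB k w - v k w).
  have := cond_centeredB mG (cond_exp_centered mG (cV k))
    (cond_exp_centered mG (cV' k)).
  congr cond_centered; apply/funext => w; rewrite /y /v /DB; ring.
have cD := cond_centered_increment hB hP ti0 tt tiT.
have cDD := cond_centered_increment2 hB hP ti0 tt tiT.
have sk k : \int[P]_w (DB k w ^+ 2) <= 8 * D.
  by have [_ _] := D_moments hB tt tiT ti0 k.
have k0 : 0 < 8 * D by rewrite mulr_gt0.
have := cond_bessel sG mG k0 sk iy mm mv cm cv cD cDD.
set H := fun w => m w ^+ 2 + (8 * D)^-1 * \sum_k v k w ^+ 2 => bessel.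
have mm' := measurable_wrt_fun mG mm.
have mv' k := measurable_wrt_fun mG (mv k).
(* A measurable version of |z_i|^2, since z_i = v / D a.e.; with kappa = 8 D the Bessel term becomes
   D / 8 * q. *)
pose q w := D^-1 ^+ 2 * \sum_k v k w ^+ 2.
have mq : measurable_fun setT q.
  apply: measurable_funM => //.
  by apply: measurable_sum => k; exact: measurable_funX.
have q0 w : 0 <= q w.
  by rewrite mulr_ge0 ?sqr_ge0// sumr_ge0// => k _; exact: sqr_ge0.
have HE w : H w = m w ^+ 2 + D / 8 * q w.
  by rewrite /H /q; congr (_ + _); field; rewrite gt_eqF.
have H0 w : 0 <= H w.
  by rewrite HE addr_ge0 ?sqr_ge0// mulr_ge0// divr_ge0// ltW.
have mH : measurable_fun setT H.
  rewrite (_ : H = fun w => m w ^+ 2 + D / 8 * q w); last exact/funext.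
  by apply: measurable_funD; [exact: measurable_funX|exact: measurable_funM].
have iH : P.-integrable setT (EFin \o H).
  apply/integrableP; split; first exact/measurable_EFinP.
  under eq_integral do rewrite /= ger0_norm//.
  apply: le_lt_trans bessel _; have /integrableP[_] := iy.
  by under eq_integral do rewrite /= ger0_norm ?sqr_ge0//.
have iq : P.-integrable setT (EFin \o q).
  (* Dropping m^2 from H gives q <= (8 / D) H, and H is integrable by Bessel's inequality. *)
  apply: (le_integrable _ _ _ (integrableZl _ (8 / D) iH)) => //.
    exact/measurable_EFinP.
  move=> w _; rewrite /= lee_fin !ger0_norm//; last first.
    by rewrite mulr_ge0// divr_ge0// ltW.
  rewrite HE mulrDr (_ : 8 / D * (D / 8 * q w) = q w); last first.
    by field; rewrite gt_eqF.
  by rewrite lerDr mulr_ge0 ?sqr_ge0// divr_ge0// ltW.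
have Zq : {ae P, forall w, enorm (Z i w - Z' i w) ^+ 2 = q w}.
  apply: filterS2 ZV ZV' => w -> ->.
  rewrite enorm_sqr /q mulr_sumr; apply: eq_bigr => k _.
  by rewrite !mxE -mulrBr exprMn.
have [iZ ->] := ae_eq_integrable hP iq Zq.
split=> //.
pose e := expR (- (growth L rho * D)).
have step : {ae P, forall w, e * (Y i w - Y' i w) ^+ 2 + D / 16 * q w <= H w}.
  near=> w.
  have zq : enorm (Z i w - Z' i w) ^+ 2 = q w by near: w.
  have Yw : Y i w = U w + D * g (t i) (Y i w) (Z i w) by near: w.
  have Yw' : Y' i w = U' w + D * g (t i) (Y' i w) (Z' i w) by near: w.
  rewrite HE -zq; apply: step_inequality => //; first exact: sqrtr_ge0.
  rewrite /m {1}Yw {1}Yw'.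
  (* The conditional expectations cancel in y_i - m, leaving D times a difference of values of g at
     the same time. *)
  have -> : U w + D * g (t i) (Y i w) (Z i w) -
      (U' w + D * g (t i) (Y' i w) (Z' i w)) - (U w - U' w) =
      D * (g (t i) (Y i w) (Z i w) - g (t i) (Y' i w) (Z' i w)) by ring.
  by rewrite normrM (gtr0_norm D0) ler_wpM2l ?(ltW D0)//; exact: glip.
have ieY : P.-integrable setT (EFin \o (fun w => e * (Y i w - Y' i w) ^+ 2)).
  exact: (integrableZl measurableT e iYi).
have iDq : P.-integrable setT (EFin \o (fun w => D / 16 * q w)).
  exact: (integrableZl measurableT (D / 16) iq).
rewrite -/e -!RintegralZl// -RintegralD//.
have iS := integrableD measurableT ieY iDq.
rewrite -lee_fin /Rintegral !fineK; try exact: integrable_fin_num.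
apply: le_trans bessel; apply: ae_ge0_le_integral => //.
- move=> w _; rewrite lee_fin addr_ge0// mulr_ge0 ?expR_ge0 ?sqr_ge0//.
  by rewrite divr_ge0// ltW.
- exact: (measurable_int P iS).
- by move=> w _; rewrite lee_fin; exact: H0.
- exact/measurable_EFinP.
- by apply: filterS step => w sw _; rewrite lee_fin.
Unshelve. all: by end_near. Qed.

End SchemeStability.

(** [C] is fixed from [T], [L] and [rho] before the probability space, the dimension, the generator
    and the partition; the value chosen blows up as L rho tends to 1. [hgt] gives the Lipschitz
    bound at the grid times, where the scheme evaluates g and which form a Lebesgue-null set. *)
Theorem theorem4p8 (R : realType) (T L rho : R)
    (hT : 0 < T) (hL : 0 < L) (hrho : rho < L^-1) :
  exists C : R, 0 < C /\
  forall (disp : measure_display) (Omega : measurableType disp)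
    (P : probability Omega R) (hP : measure_is_complete P)
    (d : nat) (B : R -> Omega -> 'rV[R]_d) (hB : is_brownian_motion P T B)
    (h : nat -> R -> 'rV[R]_d) (hh : is_orthonormal_basis T h)
    (W : nat -> R -> Omega -> R)
    (hW : forall i t, t \in `[0, T] -> is_wiener_integral P B t (h i) (W i t))
    (g : R -> R -> 'rV[R]_d -> R)
    (hg : measurable_fun (`[0, T] `*` setT `*` setT)
            (fun u : R * R * d.-tuple R =>
               g u.1.1 u.1.2 (\row_(k < d) tnth u.2 k)))
    (hg0 : (\int[lebesgue_measure]_(t in `[0%R, T])
              (`|g t 0%R 0%R| ^+ 2)%:E < +oo)%E)
    (hgL : {ae lebesgue_measure, forall t, t \in `[0, T] -> lipschitz_at g L t})
    (n : nat) (t : nat -> R) (ht : is_partition T n t)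
    (hmesh : mesh n t <= rho)
    (hgt : forall i, (i < n)%N -> lipschitz_at g L (t i))
    (Y : (Omega -> R) -> nat -> Omega -> R)
    (Z : (Omega -> R) -> nat -> Omega -> 'rV[R]_d)
    (hYZ : forall xi, L2 P (brownian_filtration P B T) xi ->
             is_scheme P B g n t xi (Y xi) (Z xi))
    (sY : nat -> (mindex -> R) -> (Omega -> R) -> R)
    (sZ : nat -> (mindex -> R) -> (Omega -> R) -> 'rV[R]_d)
    (msY : forall i, (i <= n)%N ->
             measurable_path_L2 P (brownian_filtration P B T) (sY i))
    (msZ : forall i k, (i <= n)%N ->
             measurable_path_L2 P (brownian_filtration P B T)
               (fun x xi => sZ i x xi 0 k))
    (hsY : forall i xi, (i <= n)%N -> L2 P (brownian_filtration P B T) xi ->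
             {ae P, forall w, Y xi i w = sY i (chaos_process W (t i) w) xi})
    (hsZ : forall i xi, (i <= n)%N -> L2 P (brownian_filtration P B T) xi ->
             {ae P, forall w, Z xi i w = sZ i (chaos_process W (t i) w) xi})
    (p M : nat) (xi : Omega -> R)
    (hxi : L2 P (brownian_filtration P B T) xi),
  (\big[maxe/0]_(i < n.+1)
     'E_P[fun w => (`|sY i (chaos_process W (t i) w) xi
                      - sY i (chaos_process W (t i) w)
                             (chaos_proj T P W p M xi)| ^+ 2)%R]
   + \sum_(i < n)
       \int[P]_w \int[lebesgue_measure]_(s in `[t i, t i.+1])
         (enorm (sZ i (chaos_process W (t i) w) xi
                 - sZ i (chaos_process W (t i) w)
                        (chaos_proj T P W p M xi)) ^+ 2)%:E
   <= C%:E * 'E_P[fun w => (`|xi w - chaos_proj T P W p M xi w| ^+ 2)%R])%E.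
Proof.
have Lr : L * rho < 1 by rewrite mulrC -ltr_pdivlMr// div1r.
pose c := growth L rho.
have c0 : 0 <= c := growth_ge0 hL Lr.
pose K := expR (c * T).
(* The two constants of [backward_gronwall] at t n = T: [K] for the maximum, the other summand for
   the sum. *)
pose C := K + 16 * (1 + c * T * K).
have C0 : 0 < C.
  rewrite ltr_pwDl ?expR_gt0// mulr_ge0// addr_ge0// mulr_ge0 ?expR_ge0//.
  by rewrite mulr_ge0// ltW.
exists C; split=> //.
move=> disp Omega P hP d B hB h _ W hW g _ _ _ n t ht hmesh hgt Y Z hYZ sY sZ
  _ _ hsY hsZ p M xi hxi.
set xi' := chaos_proj T P W p M xi.
have mF := brownian_filtration_measurable hB hP (lexx T).
have TT : T \in `[0, T] by rewrite in_itv/= lexx ltW.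
have Fxi' : measurable_wrt (brownian_filtration P B T) xi'.
  apply: measurable_wrt_chaos_proj => i.
  exact: (measurable_wrt_wiener hB hP (hW i T TT)).
have mxi' := measurable_wrt_fun mF Fxi'.
have mxi := measurable_wrt_fun mF hxi.1.
have mxx : measurable_fun setT (fun w => xi w - xi' w) by exact: measurable_funB.
have Exx : ('E_P[fun w => (`|xi w - xi' w| ^+ 2)%R] =
    \int[P]_w ((xi w - xi' w) ^+ 2)%:E)%E.
  by rewrite unlock; apply: eq_integral => w _; rewrite real_normK// num_real.
rewrite Exx.
have [xxoo|] := ltP (\int[P]_w ((xi w - xi' w) ^+ 2)%:E)%E +oo%E; last first.
  by rewrite leye_eq => /eqP ->; rewrite gt0_muley ?lte_fin// leey.
have ixx : P.-integrable setT (EFin \o (fun w => (xi w - xi' w) ^+ 2)).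
  apply/integrableP; split; first exact/measurable_EFinP/measurable_funX.
  by under eq_integral do rewrite /= ger0_norm ?sqr_ge0//.
have ixi := L2_integrable_sqr mF hxi.
have hxi' : L2 P (brownian_filtration P B T) xi'.
  split=> //; rewrite unlock.
  (* Written as xi - (xi - xi'), the projection is square-integrable once the right-hand side is
     finite, so the scheme can be started from it. *)
  have := integrable_sqrB mxi mxx ixi ixx.
  rewrite (_ : (fun w => _) = (fun w => xi' w ^+ 2)); last first.
    by apply/funext => w; rewrite subKr.
  move=> /integrableP[_]; apply: le_lt_trans.
  apply: ge0_le_integral => //.
  - by move=> w _; rewrite lee_fin sqr_ge0.
  - exact/measurable_EFinP/measurable_funX.
  - by apply: measurableT_comp => //; exact/measurable_EFinP/measurable_funX.
  - by move=> w _; rewrite lee_fin ler_norm.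
have S := hYZ xi hxi; have S' := hYZ xi' hxi'.
have [t0 tn tS] := ht.
pose e i := \int[P]_w ((Y xi i w - Y xi' i w) ^+ 2).
pose z i := \int[P]_w (enorm (Z xi i w - Z xi' i w) ^+ 2).
have iY i (ilen : (i <= n)%N) := scheme_diff_integrable hB hP ht S S' ilen.
have step i (ilt : (i < n)%N) : t i.+1 - t i <= rho.
  apply: le_trans hmesh; rewrite /mesh.
  exact: (le_bigmax _ (fun i : 'I_n => t i.+1 - t i) (Ordinal ilt)).
have {}step i (ilt : (i < n)%N) :=
  scheme_step hB hP hL Lr ht S S' ilt (step i ilt) (hgt i ilt).
have e0 i : (i <= n)%N -> 0 <= e i.
  by move=> _; apply: Rintegral_ge0 => w _; exact: sqr_ge0.
have z0 i : (i < n)%N -> 0 <= z i.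
  by move=> _; apply: Rintegral_ge0 => w _; exact: sqr_ge0.
have [ebound zbound] := backward_gronwall c0 t0
  (fun i ilt => ltW (tS i ilt)) e0 z0 (fun i ilt => (step i ilt).2).
have eE i : (i <= n)%N -> (\int[P]_w ((Y xi i w - Y xi' i w) ^+ 2)%:E = (e i)%:E)%E.
  by move=> ilen; rewrite /e /Rintegral fineK//; exact: integrable_fin_num (iY i ilen).
have xiE : (\int[P]_w ((xi w - xi' w) ^+ 2)%:E = (e n)%:E)%E.
  rewrite -eE//.
  have [Yn _ _ _ _] := S; have [Yn' _ _ _ _] := S'.
  apply: ae_eq_integral => //.
  - exact: (measurable_int P ixx).
  - exact: (measurable_int P (iY n (leqnn n))).
  - by apply: filterS2 Yn Yn' => w -> ->.
rewrite xiE -EFinM.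
have sYE i : (i <= n)%N ->
    ('E_P[fun w => (`|sY i (chaos_process W (t i) w) xi
                     - sY i (chaos_process W (t i) w) xi'| ^+ 2)%R] = (e i)%:E)%E.
  move=> ilen; rewrite unlock -eE//.
  apply: (ae_eq_integral_complete hP _ _).2.
    exact: (measurable_int P (iY i ilen)).
  apply: filterS2 (hsY i xi ilen hxi) (hsY i xi' ilen hxi') => w -> ->.
  by rewrite real_normK// num_real.
have sZE i : (i < n)%N ->
    (\int[P]_w \int[lebesgue_measure]_(s in `[t i, t i.+1])
       (enorm (sZ i (chaos_process W (t i) w) xi
               - sZ i (chaos_process W (t i) w) xi') ^+ 2)%:E =
     ((t i.+1 - t i) * z i)%:E)%E.
  move=> ilt; have [iz _] := step i ilt.
  have iDz := integrableZl measurableT (t i.+1 - t i) iz.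
  have lam : (lebesgue_measure (`[t i, t i.+1]%classic : set R) =
      (t i.+1 - t i)%:E)%E.
    by rewrite lebesgue_measure_itv/= lte_fin tS// -EFinB.
  transitivity (\int[P]_w ((t i.+1 - t i)%:E *
      (enorm (Z xi i w - Z xi' i w) ^+ 2)%:E))%E.
    apply: (ae_eq_integral_complete hP _ _).2; first exact: (measurable_int P iDz).
    apply: filterS2 (hsZ i xi (ltnW ilt) hxi) (hsZ i xi' (ltnW ilt) hxi') => w -> ->.
    (* The integrand does not depend on s, so the time integral only contributes the length of the
       interval. *)
    rewrite (integral_cst _ _ (enorm _ ^+ 2)%:E)//.
    by rewrite [X in (_ * X)%E]lam muleC.
  rewrite integralZl// EFinM; congr (_ * _)%E.
  by rewrite /z /Rintegral fineK//; exact: integrable_fin_num iz.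
have KE : K = expR (c * t n) by rewrite tn.
rewrite /C mulrDl EFinD; apply: leeD.
  apply/bigmax_leP; split=> [|i _].
    by rewrite lee_fin mulr_ge0 ?expR_ge0// e0.
  by rewrite sYE -1?ltnS// lee_fin KE ebound -1?ltnS.
rewrite (eq_bigr (fun i : 'I_n => ((t i.+1 - t i) * z i)%:E)); last first.
  by move=> i _; exact: sZE.
by rewrite sumEFin lee_fin -tn /K -tn.
Qed.
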